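(* Let $m\ge1$ and $\mu_1,\mu_2\in\mathbb C\setminus\{0\}$. For $j=0,1$, the variety $D_{j,m}(\mu_1,\mu_2)$ is isomorphic to the transverse Hilbert scheme $\bigl(D_{j,1}(\mu_1,\mu_2)\bigr)^{[m]}_\pi$ of $m$ points on the $D_j$-surface, where the $D_1$-surface is defined in $\mathbb C^3$ (coordinates $x,y,z$) by $$y^2x-z^2+\tfrac14+(\mu_1-\mu_2)y=0,$$ the $D_0$-surface is defined in $\mathbb C^3$ (coordinates $t,w,x$) by $$t^2-xw^2+w=0,$$ and $\pi$ is the projection onto the $x$-coordinate. In particular, for $\mu\in\mathbb C\setminus\{0\}$, $D_{1,m}(\mu,\mu)$ is biholomorphic to the space of (based) rational maps of degree $2m$ of the form $p(u)/q(u^2)$, where $q$ is a monic polynomial of degree $m$, $p$ is a polynomial of degree at most $2m-1$, and $p(u)p(-u)=1\mod q(u^2)$.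
   Context: $\mathcal S_n$ is the set of $n\times n$ companion matrices, i.e. complex matrices with all subdiagonal entries equal to $1$, arbitrary last column, and all other entries zero. Let $\mathcal O_i\subset\mathfrak{gl}(n,\mathbb C)$ ($i=1,2$) be the $GL(n,\mathbb C)$-orbit of semisimple matrices with eigenvalues $\mu_i,-\mu_i$ of multiplicities $k_i,l_i$, $k_i+l_i=n$, and put $d_i=k_i-l_i$. The variety $\{(A,B)\in\mathcal O_1\times\mathcal O_2;\ A+B\in\mathcal S_n\}$ is denoted by $D_{1,m}(\mu_1,\mu_2)$ if $n=2m+1$ and $d_1=d_2=1$, and by $D_{0,m}(\mu_1,\mu_2)$ if $n=2m+2$, $d_1=2$, $d_2=0$. The surfaces $D_{j,1}(\mu_1,\mu_2)$ are identified with the affine surfaces given in the claim. For a complex manifold $X$ and a surjective holomorphic map $\pi:X\to C$ to a $1$-dimensional complex manifold, the transverse Hilbert scheme $X^{[m]}_\pi$ is the open subset of the Hilbert scheme $X^{[m]}$ of $m$ points consisting of those $0$-dimensional subschemes $Z$ of length $m$ for which $\pi:Z\to\pi(Z)$ is an isomorphism onto the scheme-theoretic image. *)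

(* Defs.v *)
From HB Require Import structures.
From mathcomp Require Import all_boot all_order all_algebra.
From mathcomp Require Import complex.
From mathcomp Require mpoly.
From mathcomp Require Import all_classical all_reals all_analysis.

Set Implicit Arguments.
Unset Strict Implicit.
Unset Printing Implicit Defensive.

Import Order.TTheory GRing.Theory Num.Theory numFieldNormedType.Exports.
(* the notations of mpoly clash with those of mathcomp-analysis *)
Import -(notations) mpoly.

Local Open Scope classical_set_scope.
Local Open Scope ring_scope.

(* Varieties over an algebraically closed field, seen as spaces with           *)
(* functions: a set of points, a Zariski topology and a sheaf of K-valued      *)
(* regular functions.  Topology and sheaf are presented by charts; the         *)
(* coordinates of a chart are functions generating its coordinate ring, and    *)
(* only their values on the domain of the chart matter.                        *)
Record prevariety (K : fieldType) := Prevariety {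
  ambient : Type;
  points : set ambient;
  chart : Type;
  dom : chart -> set ambient;
  coords : chart -> set (ambient -> K) }.

Arguments points {K} V : rename.
Arguments dom {K} V i : rename.
Arguments coords {K} V i : rename.

Inductive poly_fun (K : fieldType) (T : Type) (S : set (T -> K)) :
    (T -> K) -> Prop :=
  | poly_cst c : poly_fun S (fun=> c)
  | poly_coord f : S f -> poly_fun S f
  | poly_add f g : poly_fun S f -> poly_fun S g ->
      poly_fun S (fun t => f t + g t)
  | poly_mul f g : poly_fun S f -> poly_fun S g ->
      poly_fun S (fun t => f t * g t).

Section Prevarieties.
Variable K : fieldType.

(* the loci {s in dom V i, h s <> 0}, with h a polynomial in the coordinates   *)
(* of the chart i, form a base of the topology                                 *)
Definition zariski_open (V : prevariety K) (U : set (ambient V)) : Prop :=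
  U `<=` points V /\
  forall t, U t -> exists i h,
    [/\ poly_fun (coords V i) h, dom V i t, h t != 0 &
        forall s, points V s -> dom V i s -> h s != 0 -> U s].

Definition regular (V : prevariety K) (U : set (ambient V))
    (f : ambient V -> K) : Prop :=
  forall t, U t -> exists i g h,
    [/\ poly_fun (coords V i) g, poly_fun (coords V i) h,
        dom V i t, h t != 0 &
        forall s, U s -> dom V i s -> h s != 0 -> f s = g s / h s].

Definition variety_morphism (V W : prevariety K)
    (phi : ambient V -> ambient W) : Prop :=
  (forall t, points V t -> points W (phi t)) /\
  forall U, zariski_open U ->
    zariski_open (points V `&` phi @^-1` U) /\
    forall f, regular U f -> regular (points V `&` phi @^-1` U) (f \o phi).

Definition isomorphic (V W : prevariety K) : Prop :=
  exists (phi : ambient V -> ambient W) (psi : ambient W -> ambient V),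
    [/\ variety_morphism phi, variety_morphism psi,
        forall t, points V t -> psi (phi t) = t &
        forall s, points W s -> phi (psi s) = s].

End Prevarieties.

(* Holomorphic maps between complex submanifolds X, Y of normed spaces: those  *)
(* which locally extend to holomorphic maps of the ambient spaces.             *)
Definition holomorphic_on (K : numFieldType) (V W : normedModType K)
    (X : set V) (f : V -> W) : Prop :=
  forall x, X x -> exists F : V -> W,
    (\forall y \near x, differentiable F y) /\
    (\forall y \near x, X y -> F y = f y).

Definition biholomorphic (K : numFieldType) (V W : normedModType K)
    (X : set V) (Y : set W) : Prop :=
  exists (f : V -> W) (g : W -> V),
    [/\ holomorphic_on X f /\ holomorphic_on Y g,
        forall x, X x -> Y (f x), forall y, Y y -> X (g y),
        forall x, X x -> g (f x) = x & forall y, Y y -> f (g y) = y].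

Section HilbertSchemes.
Variables (K : fieldType) (N : nat).
Local Notation P := (mpoly N K).

Definition is_ideal (I : set P) : Prop :=
  [/\ I 0, forall a b, I a -> I b -> I (a + b) & forall r a, I a -> I (r * a)].

(* the classes of the b_i form a K-basis of P / I *)
Definition basis_mod (m : nat) (I : set P) (b : 'I_m -> P) : Prop :=
  forall r : P, exists! c : 'rV[K]_m, I (r - \sum_i c 0 i *: b i).

Definition coord_mod (m : nat) (b : 'I_m -> P) (r : P) (I : set P) : 'rV[K]_m :=
  xget 0 [set c : 'rV[K]_m | I (r - \sum_i c 0 i *: b i)].

(* Points of X^[m] for the affine variety X = {F = 0}: the 0-dimensional       *)
(* subschemes of length m of X, given by their ideals in K[x_0, .., x_(N-1)].  *)
Definition hilb_points (F : P) (m : nat) : set (set P) :=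
  [set I | [/\ is_ideal I, I F & exists b : 'I_m -> P, basis_mod I b]].

(* phi induces an isomorphism A / J -> B / I *)
Definition induces_iso (A B : nzRingType) (phi : A -> B) (J : set A) (I : set B)
    : Prop :=
  (forall a, J a <-> I (phi a)) /\ (forall b, exists a, I (b - phi a)).

(* comorphism of the projection onto the k-th coordinate *)
Definition proj_comorphism (k : 'I_N) (h : {poly K}) : P :=
  horner_alg (mpolyX K (mnm1 k)) h.

(* ideal of the scheme-theoretic image of Spec (P / I) under the projection    *)
Definition image_ideal (k : 'I_N) (I : set P) : set {poly K} :=
  [set h | I (proj_comorphism k h)].

Definition transverse (k : 'I_N) (I : set P) : Prop :=
  induces_iso (proj_comorphism k) (image_ideal k I) I.

(* X^[m] carries the standard affine charts U_b, indexed by m-tuples b of      *)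
(* polynomials: U_b consists of the Z for which b is a basis of O(Z), and its  *)
(* coordinate ring is generated by the coefficients, in the basis b, of the    *)
(* classes in O(Z) of all polynomials r.  The transverse Hilbert scheme is an  *)
(* open subset of X^[m], with the induced structure.  (For X a smooth surface, *)
(* the only case used here, X^[m] is smooth, hence reduced, and is determined  *)
(* by its K-points and regular functions.)                                     *)
Definition transverse_hilb (F : P) (k : 'I_N) (m : nat) : prevariety K :=
  @Prevariety K (set P) (hilb_points F m `&` transverse k)
    ('I_m -> P)
    (fun b => [set I | basis_mod I b])
    (fun b => [set f | exists (r : P) (i : 'I_m),
                         f = fun I => coord_mod b r I 0 i]).

End HilbertSchemes.

Section MatrixVarieties.
Variable K : fieldType.

Definition companion (n : nat) : set 'M[K]_n :=
  [set S | forall i j : 'I_n, (j.+1 < n)%N -> S i j = (i == j.+1 :> nat)%:R].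

(* GL(n)-orbit of the semisimple matrices with eigenvalue mu of multiplicity k *)
(* and eigenvalue - mu of multiplicity n - k *)
Definition semisimple_orbit (n k : nat) (mu : K) : set 'M[K]_n :=
  [set A | exists2 g : 'M[K]_n, g \in unitmx &
     A = g *m diag_mx (\row_(i < n) if (i < k)%N then mu else - mu) *m invmx g].

Definition orbit_pairs (n k1 k2 : nat) (mu1 mu2 : K)
    : set ('M[K]_n * 'M[K]_n)%type :=
  [set AB | [/\ semisimple_orbit k1 mu1 AB.1, semisimple_orbit k2 mu2 AB.2 &
                companion (AB.1 + AB.2)]].

(* n = 2m+1, k1 = k2 = m+1, l1 = l2 = m *)
Definition D1 (m : nat) (mu1 mu2 : K) :=
  @orbit_pairs (2 * m).+1 m.+1 m.+1 mu1 mu2.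

(* n = 2m+2, k1 = m+2, l1 = m, k2 = l2 = m+1 *)
Definition D0 (m : nat) (mu1 mu2 : K) :=
  @orbit_pairs (2 * m).+2 m.+2 m.+1 mu1 mu2.

(* a set of pairs of matrices, as a subvariety of the affine space gl_n x gl_n *)
Definition matrix_variety (n : nat) (X : set ('M[K]_n * 'M[K]_n)%type)
    : prevariety K :=
  @Prevariety K ('M[K]_n * 'M[K]_n)%type X unit
    (fun=> setT)
    (fun=> [set f | exists i j : 'I_n,
              f = (fun AB : 'M[K]_n * 'M[K]_n => AB.1 i j) \/
              f = (fun AB : 'M[K]_n * 'M[K]_n => AB.2 i j)]).

End MatrixVarieties.

Arguments D1 {K} m mu1 mu2.
Arguments D0 {K} m mu1 mu2.

Section Surfaces.
Variable K : fieldType.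
Local Notation coordinate k := (mpolyX K (mnm1 (k : 'I_3))).

(* coordinates (x, y, z) *)
Definition D1_surface (mu1 mu2 : K) : mpoly 3 K :=
  let x := coordinate (@Ordinal 3 0 isT) in
  let y := coordinate (@Ordinal 3 1 isT) in
  let z := coordinate (@Ordinal 3 2 isT) in
  y ^+ 2 * x - z ^+ 2 + mpolyC 3 (4^-1) + (mu1 - mu2) *: y.

Definition D1_x : 'I_3 := @Ordinal 3 0 isT.

(* coordinates (t, w, x) *)
Definition D0_surface : mpoly 3 K :=
  let t := coordinate (@Ordinal 3 0 isT) in
  let w := coordinate (@Ordinal 3 1 isT) in
  let x := coordinate (@Ordinal 3 2 isT) in
  t ^+ 2 - x * w ^+ 2 + w.

Definition D0_x : 'I_3 := @Ordinal 3 2 isT.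

End Surfaces.

Arguments D0_surface K : clear implicits.

Section RationalMaps.
Variable K : fieldType.

(* A based rational map of degree k is written in a unique way as num / den    *)
(* with den monic of degree k, deg num < k and num, den coprime; the space of  *)
(* such maps is thus an open subset of K^k x K^k.                              *)
Definition rat_num (k : nat) (v : 'rV[K]_k * 'rV[K]_k) : {poly K} :=
  rVpoly v.1.

Definition rat_den (k : nat) (v : 'rV[K]_k * 'rV[K]_k) : {poly K} :=
  'X^k + rVpoly v.2.

Definition based_rational (k : nat) : set ('rV[K]_k * 'rV[K]_k)%type :=
  [set v | coprimep (rat_num v) (rat_den v)].

(* p(u) / q(u^2) with q monic of degree m and p(u) p(-u) = 1 mod q(u^2) *)
Definition symmetric_rational (m : nat)
    : set ('rV[K]_(2 * m) * 'rV[K]_(2 * m))%type :=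
  [set v | based_rational v /\ exists q : {poly K},
     [/\ q \is monic, size q = m.+1, rat_den v = q \Po 'X^2 &
         rat_den v %| rat_num v * (rat_num v \Po (- 'X)) - 1]].

End RationalMaps.

Arguments symmetric_rational K m : clear implicits.

(* Main.v *)
Require Import Defs.
From mathcomp Require Import all_boot all_order all_algebra.
From mathcomp Require Import complex.
From mathcomp Require mpoly.
From mathcomp Require Import all_classical all_reals all_analysis.
From mathcomp Require Import ring zify.
Import Order.TTheory GRing.Theory Num.Theory numFieldNormedType.Exports.
Import -(notations) mpoly.
Local Open Scope ring_scope.

(** Let S = A + B and d = mu1^2 - mu2^2.  As A^2 = mu1^2 and B^2 = mu2^2 are scalars,
    A S + S A = S^2 + d.  A companion matrix S is multiplication by u on K[u]/(chi), where
    chi is its characteristic polynomial, and the relation makes A a K[u^2]-linear operator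
    with A u = u^2 + d - u a, where a = A 1 ([act], [act_cvec]).  Thus (A, B) is the same as
    (chi, a), where a must be such that the ideal of chi is stable under this operator and
    that its square is mu1^2 on the cyclic vector 1.

    Stability and the square force chi = q(u^2) f(u).  Indeed, once its largest even factor
    is removed, chi divides the product of the four factors u +- mu1 +- mu2 and contains no
    pair of opposite roots; parity and the trace of S leave f = u - (mu1 + mu2) when n = 2m+1,
    and f = (u - mu1)^2 - mu2^2 when n = 2m+2 ([linear_spectral_factor],
    [quadratic_spectral_factor]).  The operator has trace 0 on K[u]/(q(u^2)), so the trace of A
    is that of the operator on K[u]/(f) ([mxtrace_act]), and fixing it means that a = mu1
    modulo f.  Write a = mu1 + f b with b = e(u^2) + u o(u^2), where e and o are polynomials of
    degree less than m.  Then the square of the operator is mu1^2 if and only if q divides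
        x o^2 - e^2 + e + (mu1 - mu2) o   or   e^2 - x o^2 + o
    in the two cases ([spectral_pairP], [pair_of_spectral], [pair_ofK]).  These are the
    equations of the surfaces, for y = o, z = e - 1/2 and t = e, w = o.

    On the other side, a subscheme Z of length m that is transverse to the projection onto x
    is a graph over its image: 1, x, ..., x^(m-1) is a basis of the functions on Z, the image is
    given by a monic polynomial q of degree m, the other coordinates are polynomials in x of
    degree less than m, and Z lies on F = 0 if and only if q divides the restriction of F to
    this graph ([transverse_basis], [ideal_section_ideal]).  So both varieties are parametrized
    by the same triples.  The correspondence is regular: the matrix entries are polynomials in
    the coefficients of q, e, o, which are themselves polynomials in the entries of A and B;
    the coefficients of q, e, o are coordinates of the chart of Z given by the powers of x, and
    any other chart is reached by Cramer's rule ([transverse_hilb_isomorphic]).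

    If mu1 = mu2, then the congruence for p = 2 b - 1 reads p(u) p(-u) = 1 modulo q(u^2)
    ([symmetric_eqn]).  The maps (A, B) |-> (p, q(u^2)) and back are polynomial, hence
    holomorphic. *)

Set Implicit Arguments.
Unset Strict Implicit.
Unset Printing Implicit Defensive.

(** * Even and odd parts, and the operator determined by the image of 1 *)

Section EvenOdd.
Variable K : fieldType.
Implicit Types (p q e o f h a : {poly K}) (d : K).

(** p(u^2): a polynomial in x = u^2 seen as an even polynomial in u. *)
Definition evp e : {poly K} := e \Po 'X^2.

Lemma evpD e f : evp (e + f) = evp e + evp f. Proof. exact: rmorphD. Qed.
Lemma evpN e : evp (- e) = - evp e. Proof. exact: rmorphN. Qed.
Lemma evpM e f : evp (e * f) = evp e * evp f. Proof. exact: rmorphM. Qed.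
Lemma evpC (c : K) : evp c%:P = c%:P. Proof. exact: comp_polyC. Qed.
Lemma evpX : evp 'X = 'X^2. Proof. exact: comp_polyX. Qed.
Lemma evpXn e k : evp (e ^+ k) = evp e ^+ k. Proof. exact: rmorphXn. Qed.
Lemma evp0 : evp 0 = 0. Proof. exact: rmorph0. Qed.
Lemma evp1 : evp 1 = 1. Proof. exact: rmorph1. Qed.

Lemma coef_evp e i : (evp e)`_i = if odd i then 0 else e`_i./2.
Proof.
rewrite /evp coef_comp_poly_Xn // dvdn2 divn2.
by case: (odd i).
Qed.

Lemma evp_inj : injective evp.
Proof.
move=> e f ef; apply/polyP=> i.
by have /(congr1 (fun p : {poly K} => p`_i.*2)) := ef; rewrite !coef_evp odd_double doubleK.
Qed.

Lemma size_evp q : q != 0 -> size (evp q) = (size q).-1.*2.+1.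
Proof.
move=> q0; have := size_comp_poly q 'X^2; rewrite size_polyXn /= => h.
have e0 : evp q != 0 by rewrite -(inj_eq evp_inj) evp0 in q0.
rewrite -/(evp q) in h; have : (0 < size (evp q))%N by rewrite size_poly_gt0.
by rewrite muln2 in h; move: h; case: (size (evp q)) => //= k ->.
Qed.

Lemma evp_monic q : q \is monic -> evp q \is monic.
Proof.
move=> mq; rewrite monicE lead_coefE size_evp ?monic_neq0 // coef_evp /= odd_double doubleK.
by rewrite -lead_coefE -monicE.
Qed.

Lemma poly_evenodd p : p = evp (even_poly p) + evp (odd_poly p) * 'X.
Proof. by rewrite /evp poly_even_odd. Qed.

Lemma even_evp e o : even_poly (evp e + evp o * 'X) = e.
Proof.
apply/polyP=> i; rewrite coef_even_poly coefD coefMX !coef_evp odd_double doubleK.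
by case: i => [|i] /=; rewrite ?addr0 ?odd_double /= ?addr0.
Qed.

Lemma odd_evp e o : odd_poly (evp e + evp o * 'X) = o.
Proof.
apply/polyP=> i; rewrite coef_odd_poly coefD coefMX !coef_evp /= odd_double /=.
by rewrite add0r doubleK.
Qed.

(** K[u] is free over K[u^2] with basis 1, u, so divisibility by an even polynomial
    is tested on the two components. *)
Lemma dvdp_evenodd q e o :
  (evp q %| evp e + evp o * 'X) = (q %| e) && (q %| o).
Proof.
apply/idP/andP=> [/dvdpP [s]|[/dvdpP [s ->] /dvdpP [t ->]]]; last first.
  by rewrite !evpM mulrAC -mulrDl dvdp_mull.
rewrite {1}(poly_evenodd s) mulrDl mulrAC -!evpM => h.
split.
  by have := congr1 (@even_poly K) h; rewrite !even_evp => ->; rewrite dvdp_mull.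
by have := congr1 (@odd_poly K) h; rewrite !odd_evp => ->; rewrite dvdp_mull.
Qed.

Lemma dvdp_evp q e : (evp q %| evp e) = (q %| e).
Proof. by have := dvdp_evenodd q e 0; rewrite evp0 mul0r addr0 dvdp0 andbT. Qed.

(** Division by q(u^2) is division by q in each component of K[u] = K[u^2] + u K[u^2]. *)
Lemma modp_evenodd q e o : q != 0 ->
  (evp e + evp o * 'X) %% evp q = evp (e %% q) + evp (o %% q) * 'X.
Proof.
move=> q0.
symmetry; apply: (@modpP _ _ (evp (e %/ q) + evp (o %/ q) * 'X)).
  rewrite {1}(divp_eq e q) {1}(divp_eq o q) !evpD !evpM; ring.
rewrite (size_evp q0); apply: (leq_ltn_trans (size_polyD _ _)).
have he := ltn_modp e q; have ho := ltn_modp o q; rewrite q0 in he ho.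
have sq : (0 < size q)%N by rewrite size_poly_gt0.
rewrite gtn_max; apply/andP; split.
  have [->|e0] := eqVneq (e %% q) 0; first by rewrite evp0 size_poly0.
  rewrite size_evp //; move: e0 he; rewrite -size_poly_gt0.
  by move: (size _) (size _) sq; lia.
have [->|e0] := eqVneq (o %% q) 0; first by rewrite evp0 mul0r size_poly0.
have e1 : evp (o %% q) != 0 by rewrite -(inj_eq evp_inj) evp0 in e0.
rewrite size_mulX // size_evp //; move: e0 ho; rewrite -size_poly_gt0.
by move: (size _) (size _) sq; lia.
Qed.

(** If A and S are operators with A S + S A = S^2 + d, then A commutes with S^2.
    When S is multiplication by u, A is therefore K[u^2]-linear, and it sends u to
    u^2 + d - u a, where a is the image of 1; this is the resulting operator. *)
Definition act d a p : {poly K} :=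
  evp (even_poly p) * a + evp (odd_poly p) * ('X^2 + d%:P - 'X * a).

Lemma act_evenodd d a e o :
  act d a (evp e + evp o * 'X) = evp e * a + evp o * ('X^2 + d%:P - 'X * a).
Proof. by rewrite /act even_evp odd_evp. Qed.

Lemma act1 d a : act d a 1 = a.
Proof. by have := act_evenodd d a 1 0; rewrite evp1 evp0 !mul0r !addr0 mul1r. Qed.

Lemma actMevp d a f p : act d a (evp f * p) = evp f * act d a p.
Proof.
rewrite {1}(poly_evenodd p) mulrDr mulrA -!evpM act_evenodd /act !evpM.
ring.
Qed.

Lemma actD d a p q : act d a (p + q) = act d a p + act d a q.
Proof. rewrite /act !raddfD /= !evpD; ring. Qed.

Lemma actN d a p : act d a (- p) = - act d a p.
Proof. by have := actMevp d a (-1) p; rewrite evpN evp1 !mulN1r. Qed.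

Lemma actZ d a c p : act d a (c *: p) = c *: act d a p.
Proof. by have := actMevp d a c%:P p; rewrite evpC !mul_polyC. Qed.

Lemma actX d a p : act d a ('X * p) = ('X^2 + d%:P) * p - 'X * act d a p.
Proof.
have -> : 'X * p = evp ('X * odd_poly p) + evp (even_poly p) * 'X.
  rewrite {1}(poly_evenodd p) evpM evpX; ring.
rewrite act_evenodd {3}(poly_evenodd p) /act evpM evpX; ring.
Qed.

(** The ideal of h is spanned over K[u^2] by h and u h, and [actX] brings the image of
    u h back to that of h. *)
Lemma dvdp_act d a h p : h %| act d a h -> h %| p -> h %| act d a p.
Proof.
move=> hh /dvdpP [s ->]; rewrite {1}(poly_evenodd s) mulrDl -mulrA actD !actMevp actX.
by apply: dvdp_add; apply: dvdp_mull => //; rewrite dvdp_sub ?dvdp_mull.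
Qed.

End EvenOdd.

(** * Shape of the characteristic polynomial *)

Section CharPoly.
Variable K : numFieldType.
Implicit Types (p q e o f h a chi : {poly K}) (c : K).

(** In terms of the odd part O of chi, stability of (chi) says that chi divides
    O (u^2 + d - 2 u a).  Multiplying by the conjugate factor 2 u a(-u) + u^2 + d and
    using that A^2 is the scalar mu1^2 removes a: what remains is
    O ((u^2 + d)^2 - 4 u^2 mu1^2), which splits with roots +-mu1 +-mu2. *)
Lemma dvdp_act_spectrum chi a (mu1 mu2 : K) (d := mu1 ^+ 2 - mu2 ^+ 2)
    (c1 := mu1 + mu2) (c2 := mu1 - mu2) :
  chi %| act d a chi -> chi %| act d a a - (mu1 ^+ 2)%:P ->
  chi %| evp (odd_poly chi) * \prod_(r <- [:: c1; - c1; c2; - c2]) ('X - r%:P).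
Proof.
move=> h1 h2.
set O := evp (odd_poly chi).
(* a(-u) *)
pose abar := evp (even_poly a) - evp (odd_poly a) * 'X.
have e1 : O * ('X^2 + d%:P - 2 * 'X * a) = act d a chi - chi * a.
  rewrite {2}(poly_evenodd chi) /act -/O; ring.
have e2 : 4 * 'X^2 * act d a a - ('X^2 + d%:P) ^+ 2
   = - ('X^2 + d%:P - 2 * 'X * a) * (2 * 'X * abar + 'X^2 + d%:P).
  rewrite /act /abar.
  have := poly_evenodd a; move: (evp _) (evp _) => ae ao ->; ring.
have e3 : \prod_(r <- [:: c1; - c1; c2; - c2]) ('X - r%:P) =
   ('X^2 + d%:P) ^+ 2 - 4 * 'X^2 * (mu1 ^+ 2)%:P.
  rewrite !big_cons big_nil /c1 /c2 /d !(rmorphB, rmorphD, rmorphN, rmorphXn) /=.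
  ring.
have -> : O * \prod_(r <- [:: c1; - c1; c2; - c2]) ('X - r%:P) =
   (act d a chi - chi * a) * (2 * 'X * abar + 'X^2 + d%:P)
   + (4 * 'X^2 * O) * (act d a a - (mu1 ^+ 2)%:P).
  rewrite e3 -e1.
  have -> : O * ('X^2 + d%:P - 2 * 'X * a) * (2 * 'X * abar + 'X^2 + d%:P)
     = - O * (4 * 'X^2 * act d a a - ('X^2 + d%:P) ^+ 2) by rewrite e2; ring.
  ring.
apply: dvdp_add; last exact: dvdp_mull.
by apply: dvdp_mulr; rewrite dvdp_sub // dvdp_mulr.
Qed.

(** The even factor is the gcd of the even and odd parts, taken in x = u^2. *)
Lemma max_even_factor chi : chi \is monic ->
  exists q f, [/\ q \is monic, f \is monic, chi = evp q * f &
    coprimep (even_poly f) (odd_poly f)].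
Proof.
move=> mchi; set E := even_poly chi; set O := odd_poly chi.
have chi0 := monic_neq0 mchi.
have EO : (E != 0) || (O != 0).
  apply: contraNT chi0; rewrite negb_or !negbK => /andP [/eqP e /eqP o].
  by rewrite (poly_evenodd chi) -/E -/O e o evp0 mul0r addr0.
pose g := gcdp E O.
have g0 : g != 0 by rewrite gcdp_eq0 negb_and.
have l0 : lead_coef g != 0 by rewrite lead_coef_eq0.
(* gcdp is only determined up to a constant *)
pose q := (lead_coef g)^-1 *: g.
have mq : q \is monic by rewrite monicE lead_coefZ mulVf.
have gq : q %= g by rewrite eqp_scale // invr_eq0.
have /dvdpP [r1 hE] : q %| E by rewrite (eqp_dvdl _ gq) dvdp_gcdl.
have /dvdpP [s1 hO] : q %| O by rewrite (eqp_dvdl _ gq) dvdp_gcdr.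
exists q, (evp r1 + evp s1 * 'X).
have hchi : chi = evp q * (evp r1 + evp s1 * 'X).
  rewrite (poly_evenodd chi) -/E -/O hE hO !evpM; ring.
have mf : evp r1 + evp s1 * 'X \is monic.
  by move: mchi; rewrite hchi (monicMl _ (evp_monic mq)).
split=> //; rewrite even_evp odd_evp.
have q0 := monic_neq0 mq.
rewrite /coprimep -(eqn_add2r (size q).-1).
have /eqp_size : q * gcdp r1 s1 %= q.
  apply: eqp_trans (mulp_gcdr _ _ _) _.
  by rewrite ![q * _]mulrC -hE -hO eqp_sym.
have go : gcdp r1 s1 != 0.
  by move: EO; rewrite hE hO gcdp_eq0 !mulf_eq0 !(negbTE q0) !orbF negb_and.
rewrite size_mul //; move: q0 go; rewrite -!size_poly_gt0.
by move: (size _) (size _); clear; lia.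
Qed.

(** A product (u - c)(u + c) is even, so it would divide both the even and the odd part. *)
Lemma evenfree_pair f c g : coprimep (even_poly f) (odd_poly f) ->
  f = ('X - c%:P) * ('X + c%:P) * g -> False.
Proof.
move=> cop hf.
have : evp ('X - (c ^+ 2)%:P) %| f.
  rewrite evpD evpN evpX evpC hf; apply/dvdpP; exists g; rewrite rmorphXn /=; ring.
rewrite {1}(poly_evenodd f) dvdp_evenodd -dvdp_gcd => /dvdp_leq.
have := cop; rewrite /coprimep => /eqP ->; rewrite size_XsubC => H.
by have : (2 <= 1)%N by apply: H; rewrite -size_poly_gt0 (eqP cop).
Qed.

(** A divisor of the product is the product over one of the sixteen subsets of the four
    roots, and the subsets containing a pair c, -c are excluded by [evenfree_pair]. *)
Lemma evenfree_cases f (c1 c2 : K) : f \is monic ->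
  coprimep (even_poly f) (odd_poly f) ->
  f %| \prod_(r <- [:: c1; - c1; c2; - c2]) ('X - r%:P) ->
  [\/ f = 1, exists r, f = 'X - r%:P |
    exists r1 r2, [/\ r1 = c1 \/ r1 = - c1, r2 = c2 \/ r2 = - c2 &
       f = ('X - r1%:P) * ('X - r2%:P)]].
Proof.
move=> mf cop /dvdp_prod_XsubC [s fs].
have {}fs : f = \prod_(i <- mask s [:: c1; - c1; c2; - c2]) ('X - i%:P).
  by apply/eqP; rewrite -eqp_monic // monic_prod_XsubC.
have nopair c g : f = ('X - c%:P) * ('X + c%:P) * g -> False.
  exact: evenfree_pair.
do 4 ?[case: s fs => [|[] s] /= fs];
  rewrite ?mask0 ?mask0s ?big_cons ?big_nil ?mulr1 in fs;
  first
    [ by constructor 1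
    | by constructor 2; eexists; exact: fs
    | by constructor 3; eexists; eexists; split; [| | exact: fs]; auto
    | exfalso; rewrite !polyCN in fs;
      first
        [ by apply: (nopair c1 1); rewrite fs; ring
        | by apply: (nopair c1 ('X - c2%:P)); rewrite fs; ring
        | by apply: (nopair c1 ('X + c2%:P)); rewrite fs; ring
        | by apply: (nopair c1 (('X - c2%:P) * ('X + c2%:P))); rewrite fs; ring
        | by apply: (nopair c2 1); rewrite fs; ring
        | by apply: (nopair c2 ('X - c1%:P)); rewrite fs; ring
        | by apply: (nopair c2 ('X + c1%:P)); rewrite fs; ring ] ].
Qed.

(** The odd part of f is coprime to f, so it can be cancelled in [dvdp_act_spectrum]. *)
Lemma dvdp_evenfree chi a q f (mu1 mu2 : K) (d := mu1 ^+ 2 - mu2 ^+ 2)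
    (c1 := mu1 + mu2) (c2 := mu1 - mu2) :
  chi %| act d a chi -> chi %| act d a a - (mu1 ^+ 2)%:P ->
  chi \is monic -> q \is monic -> f \is monic ->
  chi = evp q * f -> coprimep (even_poly f) (odd_poly f) ->
  f %| \prod_(r <- [:: c1; - c1; c2; - c2]) ('X - r%:P).
Proof.
move=> h1 h2 mchi mq mf hf cop.
have eq0 := monic_neq0 (evp_monic mq).
have oE : odd_poly chi = q * odd_poly f.
  rewrite hf {1}(poly_evenodd f) mulrDr mulrA -!evpM odd_evp //.
have := dvdp_act_spectrum h1 h2.
rewrite oE evpM {1}hf -mulrA dvdp_mul2l // Gauss_dvdpr //.
have /Bezout_eq1_coprimepP [[u v] /= uv] := cop.
apply/Bezout_eq1_coprimepP; exists (evp u, evp v - evp u * 'X) => /=.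
rewrite {1}(poly_evenodd f); rewrite -[RHS](evp1 K) -uv evpD !evpM; ring.
Qed.

(** These are the coefficients that give minus the trace of a matrix with this
    characteristic polynomial. *)
Lemma coef_evpM_top q m : q \is monic -> size q = m.+1 ->
  (forall r, (evp q * ('X - r%:P))`_m.*2 = - r) /\
  (forall c0 c1, (evp q * ('X^2 + c1 *: 'X + c0%:P))`_m.*2.+1 = c1).
Proof.
move=> mq sq.
have qm : q`_m = 1 by have /monicP := mq; rewrite lead_coefE sq.
have e1 : (evp q)`_m.*2 = 1 by rewrite coef_evp odd_double doubleK.
split=> [r|c0 c1].
  rewrite mulrBr coefB coefMX coefMC e1 mul1r coef_evp.
  by case: (m) => [|k]; rewrite ?sub0r //= odd_double sub0r.
rewrite !mulrDr !coefD coefMXn coefMC -scalerAr coefZ coefMX /= e1 mulr1.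
rewrite !coef_evp /= odd_double /= mul0r addr0.
case: (m) => [|k]; rewrite ?add0r //= odd_double.
by rewrite add0r.
Qed.

(** In degree 2m+1 the factor free of even divisors has odd degree, so it is linear, and
    the trace is its root. *)
Lemma linear_spectral_factor chi a m (mu1 mu2 : K) (d := mu1 ^+ 2 - mu2 ^+ 2) :
  chi \is monic -> size chi = m.*2.+2 -> chi`_m.*2 = - (mu1 + mu2) ->
  chi %| act d a chi -> chi %| act d a a - (mu1 ^+ 2)%:P ->
  exists q, [/\ q \is monic, size q = m.+1 & chi = evp q * ('X - (mu1 + mu2)%:P)].
Proof.
move=> mchi schi tr h1 h2.
have [q [f [mq mf hf cop]]] := max_even_factor mchi.
have q0 := monic_neq0 mq; have eq0 := monic_neq0 (evp_monic mq).
have f0 := monic_neq0 mf.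
have szchi : size chi = ((size q).-1.*2 + size f)%N.
  by rewrite hf size_mul // size_evp.
have fdvd := dvdp_evenfree h1 h2 mchi mq mf hf cop.
case: (evenfree_cases mf cop fdvd) => [f1|[r fr]|[r1 [r2 [_ _ fr]]]].
- by move: szchi; rewrite schi f1 size_poly1; clear; lia.
- have sq : size q = m.+1.
    have : (0 < size q)%N by rewrite size_poly_gt0.
    by move: szchi; rewrite schi fr size_XsubC; clear; lia.
  exists q; split=> //; rewrite hf fr; congr (_ * ('X - _%:P)).
  by apply: oppr_inj; rewrite -tr hf fr (coef_evpM_top mq sq).1.
- move: szchi; rewrite schi fr size_mul ?polyXsubC_eq0 // !size_XsubC /=; clear; lia.
Qed.

(** In degree 2m+2 the factor free of even divisors is 1 or quadratic.  The trace 2 mu1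
    is nonzero, which excludes 1 and gives the sum of the two roots +-(mu1 + mu2) and
    +-(mu1 - mu2); whenever that sum is 2 mu1, the product is d. *)
Lemma quadratic_spectral_factor chi a m (mu1 mu2 : K) (d := mu1 ^+ 2 - mu2 ^+ 2) :
  mu1 != 0 ->
  chi \is monic -> size chi = m.*2.+3 -> chi`_m.*2.+1 = - (2 * mu1) ->
  chi %| act d a chi -> chi %| act d a a - (mu1 ^+ 2)%:P ->
  exists q, [/\ q \is monic, size q = m.+1 &
     chi = evp q * ('X^2 + - (2 * mu1) *: 'X + d%:P)].
Proof.
move=> mu0 mchi schi tr h1 h2.
have [q [f [mq mf hf cop]]] := max_even_factor mchi.
have q0 := monic_neq0 mq; have eq0 := monic_neq0 (evp_monic mq).
have f0 := monic_neq0 mf.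
have szchi : size chi = ((size q).-1.*2 + size f)%N.
  by rewrite hf size_mul // size_evp.
have n2 : 2 * mu1 != 0 by rewrite mulf_neq0 // pnatr_eq0.
have fdvd := dvdp_evenfree h1 h2 mchi mq mf hf cop.
case: (evenfree_cases mf cop fdvd) => [f1|[r fr]|[r1 [r2 [hr1 hr2 fr]]]].
- move/eqP: tr; rewrite hf f1 mulr1 coef_evp /= odd_double /=.
  by rewrite eq_sym oppr_eq0 (negbTE n2).
- by move: szchi; rewrite schi fr size_XsubC; clear; lia.
- have sq : size q = m.+1.
    have : (0 < size q)%N by rewrite size_poly_gt0.
    by move: szchi; rewrite schi fr size_mul ?polyXsubC_eq0 // !size_XsubC /=; clear; lia.
  exists q; split=> //.
  have {fr} fr : f = 'X^2 + - (r1 + r2) *: 'X + (r1 * r2)%:P.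
    by rewrite fr -mul_polyC !(rmorphM, rmorphN, rmorphD) /=; ring.
  have r12 : r1 + r2 = 2 * mu1.
    by apply: oppr_inj; rewrite -tr hf fr (coef_evpM_top mq sq).2.
  rewrite hf fr r12; congr (_ * (_ + _%:P)).
  case: hr1 hr2 r12 => -> [] -> r12.
  + by rewrite /d; ring.
  + have e : mu1 = mu2.
      apply: (mulfI (_ : 2%:R != 0)); first by rewrite pnatr_eq0.
      by rewrite -r12; ring.
    by rewrite /d e; ring.
  + have e : mu1 = - mu2.
      apply: (mulfI (_ : 2%:R != 0)); first by rewrite pnatr_eq0.
      by rewrite -r12; ring.
    by rewrite /d e; ring.
  + have : 4 * mu1 = 0.
      have -> : 4 * mu1 = 2 * mu1 + 2 * mu1 by ring.
      by rewrite -{1}r12; ring.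
    by move/eqP; rewrite mulf_eq0 pnatr_eq0 (negbTE mu0).
Qed.
End CharPoly.

(** * Companion matrices as multiplication by u *)

Section Companion.
Variables (K : fieldType) (n' : nat).
Local Notation n := n'.+1.
Implicit Types (c d : K) (p q a chi : {poly K}) (A B S M : 'M[K]_n) (v : 'cV[K]_n).

Definition compmx p : 'M[K]_n :=
  \matrix_(i, j) if (j.+1 < n)%N then (i == j.+1 :> nat)%:R else - p`_i.

Lemma compmx_companion p : companion (compmx p).
Proof. by move=> i j hj; rewrite mxE hj. Qed.

(** The class of p in K[u]/(char_poly S), when S is a companion matrix: S is multiplication
    by u in the basis 1, u, u^2, ... and the first basis vector is the class of 1. *)
Definition cvec S p : 'cV[K]_n := horner_mx S p *m delta_mx 0 0.
Definition cpoly v : {poly K} := rVpoly v^T.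

Lemma cvecD S p q : cvec S (p + q) = cvec S p + cvec S q.
Proof. by rewrite /cvec rmorphD mulmxDl. Qed.
Lemma cvecN S p : cvec S (- p) = - cvec S p.
Proof. by rewrite /cvec rmorphN mulNmx. Qed.
Lemma cvecM S p q : cvec S (p * q) = horner_mx S p *m cvec S q.
Proof. by rewrite /cvec rmorphM -mulmxA. Qed.
Lemma cvecX S p : cvec S ('X * p) = S *m cvec S p.
Proof. by rewrite cvecM horner_mx_X. Qed.
Lemma cvecZ S c p : cvec S (c *: p) = c *: cvec S p.
Proof. by rewrite /cvec linearZ /= -scalemxAl. Qed.
Lemma cvec1 S : cvec S 1 = delta_mx 0 0.
Proof. by rewrite /cvec rmorph1 mul1mx. Qed.
Lemma cvec0 S : cvec S 0 = 0.
Proof. by rewrite /cvec rmorph0 mul0mx. Qed.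

Lemma coef_cpoly v (i : 'I_n) : (cpoly v)`_i = v i 0.
Proof. by rewrite coef_rVpoly_ord mxE. Qed.

Lemma size_cpoly v : (size (cpoly v) <= n)%N.
Proof. exact: size_poly. Qed.

Lemma cvec_Xn S j (i : 'I_n) : companion S -> (j < n)%N ->
  (cvec S 'X^j) i 0 = (i == j :> nat)%:R.
Proof.
move=> cS; elim: j i => [|j IH] i hj.
  by rewrite expr0 cvec1 mxE eqxx andbT.
rewrite exprS cvecX mxE (bigD1 (Ordinal (ltnW hj))) //= big1 ?addr0.
  by rewrite IH ?(ltnW hj) //= eqxx mulr1 cS.
by move=> k; rewrite -val_eqE /= => hk; rewrite IH ?(ltnW hj) // (negbTE hk) mulr0.
Qed.

Lemma poly_sum_coef p : (size p <= n)%N -> p = \sum_(j < n) p`_j *: 'X^j.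
Proof.
move=> sp; rewrite -[LHS]coefK poly_def (big_ord_widen _ (fun j => p`_j *: 'X^j) sp).
rewrite [RHS](bigID (fun j : 'I_n => (j < size p)%N)) /= [X in _ + X]big1 ?addr0 // => j.
by rewrite -leqNgt => hj; rewrite nth_default ?scale0r.
Qed.

Lemma cvec_small S p (i : 'I_n) : companion S -> (size p <= n)%N ->
  (cvec S p) i 0 = p`_i.
Proof.
move=> cS sp.
rewrite {1}(poly_sum_coef sp).
have -> : cvec S (\sum_(j < n) p`_j *: 'X^j) = \sum_(j < n) p`_j *: cvec S 'X^j.
  elim/big_rec2: _ => [|j v r _ <-]; first exact: cvec0.
  by rewrite cvecD cvecZ.
rewrite summxE [in RHS](poly_sum_coef sp) coef_sum; apply: eq_bigr => j _.
by rewrite mxE cvec_Xn // coefZ coefXn.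
Qed.

Lemma cvecK S v : companion S -> cvec S (cpoly v) = v.
Proof.
by move=> cS; apply/colP => i; rewrite cvec_small ?coef_cpoly ?size_cpoly.
Qed.

Lemma mulmx_cvec_ext S M A : companion S ->
  (forall p, M *m cvec S p = A *m cvec S p) -> M = A.
Proof.
move=> cS h; apply/matrixP=> i j.
have := congr1 (fun v : 'cV_n => v i 0) (h (cpoly (delta_mx j 0))).
by rewrite /= cvecK // -!colE !mxE.
Qed.

(** Cayley-Hamilton gives one direction; in the other, the remainder of p is read off from
    its coordinates. *)
Lemma cvec_eq0 S p : companion S -> (cvec S p == 0) = (char_poly S %| p).
Proof.
move=> cS; have c0 := monic_neq0 (char_poly_monic S).
have e : cvec S p = cvec S (p %% char_poly S).
  rewrite {1}(divp_eq p (char_poly S)) mulrC cvecD cvecM.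
  by rewrite (Cayley_Hamilton S) mul0mx add0r.
have sz : (size (p %% char_poly S)%R <= n)%N.
  by have := ltn_modp p (char_poly S); rewrite c0 size_char_poly ltnS.
rewrite /dvdp e; apply/eqP/eqP => [h|->]; last exact: cvec0.
apply/polyP=> i; rewrite coef0; case: (ltnP i n) => hi.
  by rewrite -(cvec_small (Ordinal hi) cS sz) h mxE.
by rewrite nth_default // (leq_trans sz).
Qed.

Lemma cvec_mod S p q : companion S -> char_poly S %| p - q -> cvec S p = cvec S q.
Proof. by move=> cS; rewrite -cvec_eq0 // cvecD cvecN subr_eq0 => /eqP. Qed.

(** The last column of S is the image of u^(n-1), that is, the class of u^n. *)
Lemma coef_char_poly_companion S (i : 'I_n) : companion S ->
  (char_poly S)`_i = - S i ord_max.
Proof.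
move=> cS; pose chi : {poly K} := char_poly S; rewrite -?/chi.
have schi : size chi = n.+1 by rewrite size_char_poly.
have mchi : chi`_n = 1 by have /monicP := char_poly_monic S; rewrite lead_coefE -/chi schi.
have sl : (size (chi - 'X^n)%R <= n)%N.
  apply/leq_sizeP => j; rewrite leq_eqVlt => /orP [/eqP<-|hj].
    by rewrite coefB mchi coefXn eqxx subrr.
  by rewrite coefB coefXn nth_default ?schi // gtn_eqF // subrr.
have := cvec_small i cS sl; rewrite coefB coefXn (ltn_eqF (ltn_ord i)) subr0 => <-.
have h : cvec S chi = 0 by apply/eqP; rewrite cvec_eq0.
rewrite cvecD cvecN h add0r [LHS]mxE exprS cvecX; congr (- _).
rewrite mxE (bigD1 ord_max) //= big1 ?addr0.
  by rewrite cvec_Xn // eqxx mulr1.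
by move=> k; rewrite -val_eqE /= => hk; rewrite cvec_Xn // (negbTE hk) mulr0.
Qed.

Lemma char_compmx p : p \is monic -> size p = n.+1 -> char_poly (compmx p) = p.
Proof.
move=> mp sp; apply/polyP => i; case: (ltngtP i n) => hi.
- by rewrite (coef_char_poly_companion (Ordinal hi) (compmx_companion p)) mxE /= ltnn opprK.
- by rewrite !nth_default ?sp ?size_char_poly.
- have := monicP (char_poly_monic (compmx p)); have := monicP mp.
  by rewrite !lead_coefE sp size_char_poly /= hi => -> ->.
Qed.

Lemma compmxE S : companion S -> S = compmx (char_poly S).
Proof.
move=> cS; apply/matrixP => i j; rewrite mxE; case: ifP => hj; first exact: cS.
rewrite coef_char_poly_companion // opprK; congr (S i _); apply/val_inj => /=.
by apply/eqP; rewrite eqn_leq -ltnS ltn_ord /= -ltnS ltnNge -ltnS hj.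
Qed.

(** The relation determines A on u p from A on p, so A is known as soon as its value on the
    cyclic vector is. *)
Lemma act_cvec d S A p : companion S ->
  A *m S + S *m A = S *m S + d%:M ->
  A *m cvec S p = cvec S (act d (cpoly (col 0 A)) p).
Proof.
move=> cS h; elim/poly_ind: p => [|p c IH].
  have := actMevp d (cpoly (col 0 A)) 0 0; rewrite evp0 !mul0r => ->.
  by rewrite !cvec0 mulmx0.
have -> : p * 'X + c%:P = 'X * p + c *: 1 by rewrite alg_polyC mulrC.
rewrite actD actZ act1 actX !cvecD !cvecZ cvecN !cvecX cvecK // cvec1 mulmxDr -scalemxAr -colE.
congr (_ + _); rewrite mulrDl cvecD exprS expr1 -mulrA mul_polyC cvecZ !cvecX.
rewrite -IH mulmxA -[A *m S](addrK (S *m A)) h mulmxBl mulmxDl mul_scalar_mx.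
by rewrite -!mulmxA.
Qed.

(** The matrix of [act d a] on K[u]/(char_poly S), when the ideal of char_poly S is stable. *)
Definition actmx d S a : 'M[K]_n := \matrix_(i, j) (cvec S (act d a 'X^j)) i 0.

Lemma mul_actmx d S a p : companion S -> char_poly S %| act d a (char_poly S) ->
  actmx d S a *m cvec S p = cvec S (act d a p).
Proof.
move=> cS h; pose chi : {poly K} := char_poly S; rewrite -?/chi.
have -> : cvec S p = cvec S (p %% chi).
  by apply: cvec_mod => //; rewrite {1}(divp_eq p chi) addrK dvdp_mull.
have -> : cvec S (act d a p) = cvec S (act d a (p %% chi)).
  apply: cvec_mod => //; rewrite -actN -actD; apply: dvdp_act => //.
  by rewrite {1}(divp_eq p chi) addrK dvdp_mull.
have sz : (size (p %% chi)%R <= n)%N.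
  have := ltn_modp p chi; rewrite (monic_neq0 (char_poly_monic S)).
  by rewrite size_char_poly ltnS.
move: (p %% chi) sz => {}p sp.
have -> : cvec S (act d a p) = \sum_(j < n) p`_j *: cvec S (act d a 'X^j).
  rewrite {1}(poly_sum_coef sp); elim/big_rec2: _ => [|j v r _ <-].
    have := actMevp d a 0 0; rewrite evp0 !mul0r => ->; exact: cvec0.
  by rewrite actD actZ cvecD cvecZ.
apply/colP => i; rewrite mxE summxE; apply: eq_bigr => j _.
by rewrite cvec_small // !mxE mulrC.
Qed.

Lemma actmx_intertwine d S a : companion S -> char_poly S %| act d a (char_poly S) ->
  actmx d S a *m S + S *m actmx d S a = S *m S + d%:M.
Proof.
move=> cS h; apply: (mulmx_cvec_ext cS) => p.
rewrite !mulmxDl -!mulmxA mul_scalar_mx -cvecX !mul_actmx // actX cvecD cvecN cvecX subrK.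
by rewrite mulrDl exprS expr1 -mulrA mul_polyC cvecD cvecZ !cvecX.
Qed.

Lemma col0_actmx d S a : companion S -> (size a <= n)%N -> cpoly (col 0 (actmx d S a)) = a.
Proof.
move=> cS sa; apply/polyP=> i; case: (ltnP i n) => hi.
  by rewrite (coef_cpoly _ (Ordinal hi)) mxE mxE expr0 act1 cvec_small.
by rewrite !nth_default // ?(leq_trans sa) // (leq_trans (size_cpoly _)).
Qed.

Lemma actmxE d S A : companion S ->
  A *m S + S *m A = S *m S + d%:M -> A = actmx d S (cpoly (col 0 A)).
Proof.
move=> cS h; apply/matrixP => i j; rewrite mxE -act_cvec //.
rewrite mxE (bigD1 j) //= big1 ?addr0; last first.
  by move=> k kj; rewrite cvec_Xn // (_ : (k == j :> nat) = false) ?mulr0 //; apply/negbTE.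
by rewrite cvec_Xn // eqxx mulr1.
Qed.

(** A^2 commutes with S, so it is a scalar as soon as it acts as that scalar on the cyclic
    vector. *)
Lemma act_sqr_mx d S A (c : K) : companion S ->
  A *m S + S *m A = S *m S + d%:M ->
  (A *m A = c%:M) <-> char_poly S %| act d (cpoly (col 0 A)) (cpoly (col 0 A)) - c%:P.
Proof.
move=> cS h; set a := cpoly _.
have e : A *m A *m delta_mx 0 0 = cvec S (act d a a).
  by rewrite -mulmxA -(cvec1 S) !(act_cvec _ cS h) act1.
rewrite -cvec_eq0 // cvecD cvecN -[c%:P]alg_polyC cvecZ cvec1 -e.
split=> [->|]; first by rewrite mul_scalar_mx subrr.
rewrite subr_eq0 => /eqP {}e.
have AS : A *m S = S *m S + d%:M - S *m A by rewrite -h addrK.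
have ASS : A *m S *m S = S *m S *m A.
  rewrite AS mulmxBl -!mulmxA AS mulmxBr mulmxDl mulmxDr mul_scalar_mx mul_mx_scalar.
  by rewrite opprB addrC -!mulmxA subrK.
have com : A *m A *m S = S *m (A *m A).
  rewrite -mulmxA AS mulmxBr mulmxDr !mulmxA ASS AS mulmxBl mulmxDl.
  by rewrite mul_scalar_mx mul_mx_scalar opprB addrC subrK.
apply: (mulmx_cvec_ext cS) => p; rewrite mul_scalar_mx.
have comp : A *m A *m horner_mx S p = horner_mx S p *m (A *m A).
  by apply: comm_mx_horner; rewrite /comm_mx com.
by rewrite /cvec mulmxA comp -mulmxA e -scalemxAr.
Qed.

End Companion.

(** * Traces through Euclidean division *)

Section Trace.
Variables (K : fieldType) (n' : nat).
Local Notation n := n'.+1.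
Implicit Types (c d : K) (p q a chi f h : {poly K}) (A S : 'M[K]_n) (v : 'cV[K]_n).

Definition pcol p : 'cV[K]_n := \col_i p`_i.

Lemma cvec_pcol S p : companion S -> (size p <= n)%N -> cvec S p = pcol p.
Proof. by move=> cS sp; apply/colP=> i; rewrite cvec_small // mxE. Qed.

Lemma cpoly_cvec S p : companion S -> cpoly (cvec S p) = p %% char_poly S.
Proof.
move=> cS; pose chi : {poly K} := char_poly S; rewrite -/chi.
have sz : (size (p %% chi)%R <= n)%N.
  by have := ltn_modp p chi; rewrite (monic_neq0 (char_poly_monic S)) size_char_poly ltnS.
have -> : cvec S p = cvec S (p %% chi).
  by apply: cvec_mod => //; rewrite {1}(divp_eq p chi) addrK dvdp_mull.
apply/polyP => i; case: (ltnP i n) => hi.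
  by rewrite (coef_cpoly _ (Ordinal hi)) cvec_small.
by rewrite !nth_default // ?(leq_trans sz) // (leq_trans (size_cpoly _)).
Qed.

(** The trace in the basis 1, ..., u^(k-1), h, u h, ..., u^(r-1) h: its dual basis consists
    of the coefficients of the remainder and of the quotient in the division by h. *)
Lemma mxtrace_euclid A h k r : h \is monic -> size h = k.+1 -> n = (k + r)%N ->
  \tr A = \sum_(0 <= j < k) (cpoly (A *m pcol 'X^j) %% h)`_j
        + \sum_(0 <= i < r) (cpoly (A *m pcol (h * 'X^i)) %/ h)`_i.
Proof.
move=> mh sh nkr; have h0 := monic_neq0 mh.
pose g j : {poly K} := if (j < k)%N then 'X^j else h * 'X^(j - k).
(* the dual basis of g, as linear functionals on polynomials *)
pose L i p : K := if (i < k)%N then (p %% h)`_i else (p %/ h)`_(i - k).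
have LD i p q : L i (p + q) = L i p + L i q.
  by rewrite /L modpD divpD !coefD; case: ifP.
have LZ i c p : L i (c *: p) = c * L i p.
  by rewrite /L modpZl divpZl !coefZ; case: ifP.
have L0 i : L i 0 = 0 by rewrite /L mod0p div0p !coef0; case: ifP.
pose G : 'M[K]_n := \matrix_(i, j) (g j)`_i.
pose H : 'M[K]_n := \matrix_(i, j) L i 'X^j.
have HE v i : (H *m v) i 0 = L i (cpoly v).
  have -> : cpoly v = \sum_(j < n) v j 0 *: 'X^j.
    rewrite /cpoly /rVpoly poly_def; apply: eq_bigr => j _.
    by rewrite insubT // => lt_j; rewrite mxE; congr (v _ 0 *: _); apply: val_inj.
  rewrite mxE; elim/big_rec2: _ => [|j x y _ ->]; first by rewrite L0.
  by rewrite LD LZ mxE mulrC.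
have colG j : col j G = pcol (g j) by apply/colP => i; rewrite !mxE.
have sg (j : 'I_n) : (size (g j) <= n)%N.
  rewrite /g; case: ifP => [_|/negbT]; first by rewrite size_polyXn.
  rewrite -leqNgt => hj; rewrite size_mulXn // sh; have := ltn_ord j; lia.
have cpG (j : 'I_n) : cpoly (pcol (g j)) = g j.
  apply/polyP=> i; case: (ltnP i n) => hi.
    by rewrite (coef_cpoly _ (Ordinal hi)) mxE.
  by rewrite !nth_default // ?(leq_trans (sg j)) // (leq_trans (size_cpoly _)).
have HG : H *m G = 1%:M.
  apply/matrixP => i j.
  have -> : (H *m G) i j = (H *m col j G) i 0.
    by rewrite !mxE; apply: eq_bigr => l _; rewrite !mxE.
  rewrite HE colG cpG !mxE -val_eqE /= /L /g.
  case: (ltnP j k) => hj.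
    have hs : (size ('X^j : {poly K}) < size h)%N by rewrite size_polyXn sh !ltnS.
    rewrite modp_small // divp_small // coef0 coefXn; case: ifP => // /negbT.
    by rewrite -leqNgt => hi; rewrite gtn_eqF //; lia.
  rewrite modp_mulr coef0 mulKp // coefXn.
  case: ifP => [hi|/negbT]; first by rewrite ltn_eqF //; lia.
  rewrite -leqNgt => hi; congr (_ %:R); congr nat_of_bool; apply/eqP/eqP; lia.
have GH : G *m H = 1%:M by apply: mulmx1C.
have -> : \tr A = \tr (H *m (A *m G)).
  by rewrite mxtrace_mulC -mulmxA GH mulmx1.
have tE (i : 'I_n) : (H *m (A *m G)) i i = L i (cpoly (A *m pcol (g i))).
  by rewrite -HE -colG [col i G]colE !mulmxA -colE [in RHS]mxE.
rewrite /mxtrace (eq_bigr _ (fun i _ => tE i)).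
rewrite -(big_mkord xpredT (fun i => L i (cpoly (A *m pcol (g i))))).
have split_sum (F : nat -> K) :
    \sum_(0 <= i < n) F i = \sum_(0 <= j < k) F j + \sum_(0 <= i < r) F (i + k)%N.
  rewrite nkr (@big_cat_nat _ _ _ k) ?leq_addr //=; congr (_ + _).
  by rewrite -{1}[k]add0n big_addn addKn.
rewrite split_sum; congr (_ + _); apply: eq_big_nat => j /andP [_ hj].
  by rewrite /L /g hj.
by rewrite /L /g ltnNge leq_addl /= addnK.
Qed.

Lemma modp_modM p h f : (p %% (h * f)) %% h = p %% h.
Proof. by rewrite [in RHS](divp_eq p (h * f)) modpD mulrCA modp_mulr add0r. Qed.

Lemma actvX d a : act d a 'X = 'X^2 + d%:P - 'X * a.
Proof. by have := actX d a 1; rewrite act1 !mulr1. Qed.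

(** This is the trace on K[u]/(q(u^2)), the sum of K[x]/(q) and u K[x]/(q).  The diagonal
    blocks are multiplication by the even part of a and by its opposite. *)
Lemma sum_act_quotient d a q m : q \is monic -> size q = m.+1 ->
  \sum_(0 <= j < m.*2) (act d a 'X^j %% evp q)`_j = 0.
Proof.
move=> mq sq; have q0 := monic_neq0 mq.
have -> (F : nat -> K) : \sum_(0 <= j < m.*2) F j = \sum_(0 <= i < m) (F i.*2 + F i.*2.+1).
  elim: (m) => [|k IH]; first by rewrite !big_geq.
  by rewrite doubleS !big_nat_recr //= IH addrA.
apply: big1 => i _.
have XE : 'X^(i.*2) = evp 'X^i :> {poly K} by rewrite /evp rmorphXn /= comp_polyX -exprM mul2n.
have -> : act d a 'X^(i.*2) = evp ('X^i * even_poly a) + evp ('X^i * odd_poly a) * 'X.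
  by rewrite XE -[evp _]mulr1 actMevp act1 {1}(poly_evenodd a) !evpM; ring.
have -> : act d a 'X^(i.*2.+1) =
    evp ('X^i * ('X + d%:P - 'X * odd_poly a)) + evp (- ('X^i * even_poly a)) * 'X.
  rewrite exprSr XE actMevp actvX {1}(poly_evenodd a).
  rewrite !(evpM, evpD, evpN, evpC, evpX); ring.
rewrite !modp_evenodd // !coefD !coefMX !coef_evp /= odd_double /= doubleK.
case: (i) => [|k] /=; first by rewrite modpN coefN addr0 add0r subrr.
by rewrite odd_double /= modpN coefN addr0 add0r subrr.
Qed.

(** The multiples of q(u^2) form a stable subspace, isomorphic to K[u]/(f) with the
    operator [act d a]; the quotient K[u]/(q(u^2)) does not contribute, by
    [sum_act_quotient]. *)
Lemma mxtrace_act d S A q f m r : companion S ->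
  A *m S + S *m A = S *m S + d%:M ->
  q \is monic -> size q = m.+1 -> char_poly S = evp q * f -> size f = r.+1 ->
  \tr A = \sum_(0 <= i < r) (act d (cpoly (col 0 A)) 'X^i %% f)`_i.
Proof.
move=> cS h mq sq chiE sf; set a := cpoly _.
have q0 := monic_neq0 mq; have e0 := monic_neq0 (evp_monic mq).
have f0 : f != 0 by rewrite -size_poly_gt0 sf.
have se : size (evp q) = m.*2.+1 by rewrite size_evp // sq.
have nE : n = (m.*2 + r)%N.
  have := size_char_poly S; rewrite chiE size_mul // se sf; lia.
rewrite (mxtrace_euclid A (evp_monic mq) se nE).
rewrite [X in X + _](_ : _ = 0) ?add0r; last first.
  rewrite -[RHS](sum_act_quotient d a mq sq); apply: eq_big_nat => j /andP [_ hj].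
  rewrite -(cvec_pcol cS) ?size_polyXn; last by rewrite nE; lia.
  rewrite (act_cvec _ cS h) (cpoly_cvec _ cS) chiE.
  by rewrite modp_modM.
apply: eq_big_nat => i /andP [_ hi].
rewrite -(cvec_pcol cS); last by rewrite size_mulXn // se nE; lia.
rewrite (act_cvec _ cS h) (cpoly_cvec _ cS) chiE actMevp.
suff -> : (evp q * act d a 'X^i) %% (evp q * f) = evp q * (act d a 'X^i %% f).
  by rewrite mulKp.
symmetry; apply: (@modpP _ _ (act d a 'X^i %/ f)).
  rewrite {1}(divp_eq (act d a 'X^i) f); ring.
have [->|y0] := eqVneq (act d a 'X^i %% f) 0.
  by rewrite mulr0 size_poly0 size_poly_gt0 mulf_neq0.
rewrite !size_mul // se; have := ltn_modp (act d a 'X^i) f; rewrite f0.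
rewrite !addSn /= ltn_add2l; exact.
Qed.

Lemma mxtrace_act_linear d S A q m c : companion S ->
  A *m S + S *m A = S *m S + d%:M ->
  q \is monic -> size q = m.+1 -> char_poly S = evp q * ('X - c%:P) ->
  \tr A = (cpoly (col 0 A)).[c].
Proof.
move=> cS h mq sq chiE; rewrite (mxtrace_act cS h mq sq chiE (size_XsubC c)).
by rewrite big_nat1 expr0 act1 modp_XsubC coefC.
Qed.

Lemma size_quadratic (u v : K) : size ('X^2 + u *: 'X + v%:P) = 3.
Proof.
rewrite -addrA size_polyDl size_polyXn //.
apply: (leq_ltn_trans (size_polyD _ _)); rewrite gtn_max.
by rewrite (leq_ltn_trans (size_scale_leq _ _)) ?size_polyX // (leq_ltn_trans (size_polyC_leq1 _)).
Qed.

Lemma mxtrace_act_quadratic d S A q m (mu : K) (f : {poly K} := 'X^2 + - (2 * mu) *: 'X + d%:P)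
   (a : {poly K} := cpoly (col 0 A)) : companion S ->
  A *m S + S *m A = S *m S + d%:M ->
  q \is monic -> size q = m.+1 -> char_poly S = evp q * f ->
  \tr A = 2 * mu * (1 - (a %% f)`_1).
Proof.
move=> cS h mq sq chiE; have sf : size f = 3 := size_quadratic _ _.
rewrite (mxtrace_act cS h mq sq chiE sf).
rewrite big_nat_recl // big_nat1 expr0 act1 expr1 -/a.
rewrite actvX.
set al := (a %% f)`_0; set be := (a %% f)`_1.
have aE : a %% f = al%:P + be *: 'X.
  apply/polyP => i; rewrite coefD coefC coefZ coefX.
  case: i => [|[|i]] /=; rewrite ?mulr0 ?addr0 ?mulr1 ?add0r //.
  have := ltn_modp a f; rewrite -size_poly_gt0 sf /= => hs.
  by rewrite nth_default //; lia.
have -> : ('X^2 + d%:P - 'X * a) %% f = (be * d)%:P + (2 * mu - al - 2 * mu * be) *: 'X.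
  symmetry; apply: (@modpP _ _ (1 - 'X * (a %/ f) - be%:P)).
    rewrite {1}(divp_eq a f) aE /f -!mul_polyC !(rmorphM, rmorphB, rmorphN, rmorphD) /=; ring.
  rewrite sf ltnS; apply: (leq_trans (size_polyD _ _)); rewrite geq_max.
  by rewrite (leq_trans (size_scale_leq _ _)) ?size_polyX // (leq_trans (size_polyC_leq1 _)).
rewrite coefD coefC coefZ coefX /=; ring.
Qed.

End Trace.

(** * Semisimple matrices with two opposite eigenvalues *)

Section Orbit.
Variable K : numFieldType.

(** A factorization P = C R of full rank satisfies R C = 1, so the trace of P is its rank. *)
Lemma idempotent_factor n k (P : 'M[K]_n) : P *m P = P -> \tr P = k%:R ->
  exists (C : 'M[K]_(n, k)) (R : 'M[K]_(k, n)), C *m R = P /\ R *m C = 1%:M.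
Proof.
move=> PP tP.
have RC : row_base P *m col_base P = 1%:M.
  apply: (row_full_inj (col_base_full P)).
  apply: (row_free_inj (row_base_free P)).
  by rewrite /= mulmx1 mulmx_base mulmxA mulmx_base -mulmxA mulmx_base PP.
have : (\rank P)%:R = k%:R :> K.
  by rewrite -tP -[in RHS](mulmx_base P) mxtrace_mulC RC mxtrace1.
move/eqP; rewrite eqr_nat => /eqP rk.
move: (col_base P) (row_base P) (mulmx_base P) RC; rewrite rk => C R h1 h2.
by exists C, R.
Qed.

(** A = mu (P - Q) for the complementary idempotents P, Q = (1 +- A / mu) / 2; their images
    are the eigenspaces, and the trace gives the dimensions. *)
Lemma involution_diagonal k l (A : 'M[K]_(k + l)) (mu : K) : mu != 0 ->
  A *m A = (mu ^+ 2)%:M -> \tr A = (k%:R - l%:R) * mu ->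
  exists2 g : 'M[K]_(k + l), g \in unitmx &
     A = g *m diag_mx (\row_(i < k + l) if (i < k)%N then mu else - mu) *m invmx g.
Proof.
move=> mu0 AA tA; have m2 : 2 * mu != 0 by rewrite mulf_neq0 // pnatr_eq0.
pose P : 'M[K]_(k + l) := (2 * mu)^-1 *: (A + mu%:M).
pose Q : 'M[K]_(k + l) := (2 * mu)^-1 *: (mu%:M - A).
have PQ1 : P + Q = 1%:M.
  rewrite -scalerDr [_ - A]addrC addrACA subrr add0r [_ + _](_ : _ = (2 * mu)%:M); last first.
    by rewrite -raddfD /=; congr scalar_mx; ring.
  by rewrite -[X in X%:M]mulr1 -scale_scalar_mx scalerA mulVf // scale1r.
have PQ0 : P *m Q = 0.
  rewrite -scalemxAl -scalemxAr mulmxDl !mulmxBr AA.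
  rewrite mul_mx_scalar !mul_scalar_mx scale_scalar_mx expr2.
  by rewrite addrA subrK subrr !scaler0.
have QE : Q = 1%:M - P by rewrite -PQ1 addrC addKr.
have PP : P *m P = P by rewrite -[RHS]mulmx1 -PQ1 mulmxDr PQ0 addr0.
have QP0 : Q *m P = 0 by rewrite QE mulmxBl mul1mx PP subrr.
have QQ : Q *m Q = Q by rewrite -[RHS]mulmx1 -PQ1 mulmxDr QP0 add0r.
have tP : \tr P = k%:R.
  rewrite linearZ /= linearD /= tA mxtrace_scalar -[mu *+ _]mulr_natr natrD.
  by apply: (mulfI m2); rewrite mulrA divff //; ring.
have tQ : \tr Q = l%:R.
  by rewrite QE linearB /= mxtrace1 tP natrD addrC addKr.
have [C [R [CR RC]]] := idempotent_factor PP tP.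
have [C' [R' [CR' RC']]] := idempotent_factor QQ tQ.
have RC'0 : R *m C' = 0.
  have <- : R *m (P *m Q) *m C' = R *m C'.
    by rewrite -CR -CR' -!mulmxA RC' mulmx1 (mulmxA R) RC mul1mx.
  by rewrite PQ0 mulmx0 mul0mx.
have R'C0 : R' *m C = 0.
  have <- : R' *m (Q *m P) *m C = R' *m C.
    by rewrite -CR -CR' -!mulmxA RC mulmx1 (mulmxA R') RC' mul1mx.
  by rewrite QP0 mulmx0 mul0mx.
pose g := row_mx C C'; pose h := col_mx R R'.
have hg : h *m g = 1%:M.
  by rewrite mul_col_row RC RC' RC'0 R'C0 -scalar_mx_block.
have gh := mulmx1C hg.
have [ug _] := mulmx1_unit gh.
exists g => //.
have -> : invmx g = h by rewrite -[LHS]mulmx1 -gh mulmxA mulVmx // mul1mx.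
have -> : (\row_(i < k + l) if (i < k)%N then mu else - mu) =
    row_mx (const_mx mu) (const_mx (- mu)).
  by apply/rowP => i; rewrite !mxE; case: splitP => j _; rewrite !mxE.
rewrite diag_mx_row !diag_const_mx /g /h mul_row_block !mulmx0 addr0 add0r.
rewrite !mul_mx_scalar mul_row_col.
rewrite -!scalemxAl CR CR' scaleNr -scalerBr /P /Q -scalerBr scalerA.
have -> : A + mu%:M - (mu%:M - A) = 2 *: A.
  by rewrite opprB -addrA (addrCA mu%:M) subrr addr0 scaler_nat mulr2n.
by rewrite scalerA [_ * 2](_ : _ = 1) ?scale1r // mulrC invfM mulrA; field; rewrite mu0.
Qed.

Lemma diagonal_involution n k (A g : 'M[K]_n) (mu : K) : (k <= n)%N -> g \in unitmx ->
  A = g *m diag_mx (\row_(i < n) if (i < k)%N then mu else - mu) *m invmx g ->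
  A *m A = (mu ^+ 2)%:M /\ \tr A = (k%:R - (n - k)%:R) * mu.
Proof.
move=> kn ug ->; set D := diag_mx _; split.
  have DD : D *m D = (mu ^+ 2)%:M.
    rewrite mulmx_diag -diag_const_mx; congr diag_mx; apply/rowP => i; rewrite !mxE.
    by case: ifP => _; rewrite ?mulrNN expr2.
  rewrite -!mulmxA (mulmxA (invmx g)) mulVmx // mul1mx (mulmxA D) DD mulmxA.
  by rewrite mul_mx_scalar -scalemxAl mulmxV // scalemx1.
rewrite -mulmxA mxtrace_mulC -mulmxA mulVmx // mulmx1 mxtrace_diag.
under eq_bigr do rewrite mxE.
rewrite -(big_mkord xpredT (fun i => if (i < k)%N then mu else - mu)).
rewrite (big_cat_nat _ kn) //= [X in X + _](_ : _ = \sum_(0 <= i < k) mu); last first.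
  by apply: eq_big_nat => i /andP [_ ->].
rewrite [X in _ + X](_ : _ = \sum_(k <= i < n) - mu); last first.
  by apply: eq_big_nat => i /andP [ki _]; rewrite ltnNge ki.
by rewrite !big_const_nat !iter_addr_0 subn0 -(mulr_natl mu) -(mulr_natl (- mu)); ring.
Qed.
End Orbit.

(** * Pairs of matrices and triples of polynomials *)

Section Spectral.
Variables (K : numFieldType) (m n' : nat).
Local Notation n := n'.+1.
Implicit Types (p a chi : {poly K}) (q e o : 'rV[K]_m) (A B S : 'M[K]_n) (c d : K).

Definition spectral_pair (mu1 mu2 t1 t2 : K) (AB : 'M[K]_n * 'M[K]_n) : Prop :=
  [/\ companion (AB.1 + AB.2),
      AB.1 *m AB.1 = (mu1 ^+ 2)%:M /\ \tr AB.1 = t1 &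
      AB.2 *m AB.2 = (mu2 ^+ 2)%:M /\ \tr AB.2 = t2].

(** For B = S - A this turns the condition on B^2 into a condition on A and S. *)
Lemma sqr_sub_mx A S (c1 c2 : K) : A *m A = c1%:M ->
  (S - A) *m (S - A) = c2%:M <-> A *m S + S *m A = S *m S + (c1 - c2)%:M.
Proof.
move=> AA; have -> : (S - A) *m (S - A) = S *m S + c1%:M - (A *m S + S *m A).
  by rewrite mulmxBl !mulmxBr AA opprB addrA opprD -!addrA; congr (_ + _);
    rewrite addrC -!addrA; congr (_ + _); rewrite addrC.
split=> [h|->]; last by rewrite opprD addrACA subrr add0r -raddfB /= subKr.
by rewrite raddfB /= -h addrA subKr.
Qed.

Definition monic_of (v : 'rV[K]_m) : {poly K} := 'X^m + rVpoly v.

Definition eo_poly (e o : 'rV[K]_m) : {poly K} := evp (rVpoly e) + evp (rVpoly o) * 'X.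

(** What the two families have in common: the characteristic polynomial of A + B is
    q(u^2) f with f fixed, the image of 1 under A is mu1 modulo f, and writing this image as
    mu1 + f (e(u^2) + u o(u^2)), the equation A^2 = mu1^2 means that q divides psi e o.
    The numbers t1 and t2 are the traces of A and B. *)
Record fixed_factor (mu1 mu2 t1 t2 : K) (f : {poly K}) (r : nat)
    (psi : {poly K} -> {poly K} -> {poly K}) : Prop := FixedFactor {
  ff_dim : n = (m.*2 + r)%N;
  ff_size : size f = r.+1;
  ff_monic : f \is monic;
  ff_odd : exists2 k, k != 0 & odd_poly f = k%:P;
  ff_act : forall b, f %| act (mu1 ^+ 2 - mu2 ^+ 2) (mu1%:P + f * b) f;
  ff_eqn : forall e o : {poly K}, exists g k, [/\ k != 0, odd_poly g = k%:P &
     let a := mu1%:P + f * (evp e + evp o * 'X) in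
     act (mu1 ^+ 2 - mu2 ^+ 2) a a - (mu1 ^+ 2)%:P = f * (g * evp (psi e o))];
  ff_top : forall q : {poly K}, q \is monic -> size q = m.+1 -> (evp q * f)`_n' = - (t1 + t2);
  ff_char : forall chi a (d := mu1 ^+ 2 - mu2 ^+ 2),
    chi \is monic -> size chi = n.+1 -> chi`_n' = - (t1 + t2) ->
    chi %| act d a chi -> chi %| act d a a - (mu1 ^+ 2)%:P ->
    exists q : {poly K}, [/\ q \is monic, size q = m.+1 & chi = evp q * f];
  ff_trace : forall S A (q : {poly K}) (d := mu1 ^+ 2 - mu2 ^+ 2) (a := cpoly (col 0 A)),
     companion S ->
     A *m S + S *m A = S *m S + d%:M -> q \is monic -> size q = m.+1 ->
     char_poly S = evp q * f -> f %| act d a f ->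
     (\tr A = t1 <-> f %| a - mu1%:P)
}.

Variables (mu1 mu2 t1 t2 : K) (f : {poly K}) (r : nat)
  (psi : {poly K} -> {poly K} -> {poly K}).
Hypothesis F : fixed_factor mu1 mu2 t1 t2 f r psi.
Local Notation d := (mu1 ^+ 2 - mu2 ^+ 2).

(** The odd part of f is a constant, so that the odd coefficients of q(u^2) f are those of q
    up to this constant, and char_poly (A + B) has its coefficients in the last column. *)
Definition pair_den (AB : 'M[K]_n * 'M[K]_n) : 'rV[K]_m :=
  \row_i (- (f`_1)^-1 * (AB.1 + AB.2) (inord i.*2.+1) ord_max).
Definition pair_num (AB : 'M[K]_n * 'M[K]_n) : {poly K} :=
  (cpoly (col 0 AB.1) - mu1%:P) %/ f.
Definition pair_even AB : 'rV[K]_m := \row_i (pair_num AB)`_i.*2.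
Definition pair_odd AB : 'rV[K]_m := \row_i (pair_num AB)`_i.*2.+1.

Definition sum_of (q : 'rV[K]_m) : 'M[K]_n := compmx n' (evp (monic_of q) * f).
Definition pair_of (q e o : 'rV[K]_m) : 'M[K]_n * 'M[K]_n :=
  let A := actmx d (sum_of q) (mu1%:P + f * eo_poly e o) in (A, sum_of q - A).

Lemma monic_of_size q : size (monic_of q) = m.+1.
Proof. by rewrite /monic_of size_polyDl ?size_polyXn // ltnS size_poly. Qed.

Lemma monic_of_monic q : monic_of q \is monic.
Proof.
rewrite monicE lead_coefE monic_of_size coefD coefXn eqxx nth_default ?addr0 //.
exact: size_poly.
Qed.

Lemma monic_ofK p : p \is monic -> size p = m.+1 -> monic_of (\row_i p`_i) = p.
Proof.
move=> mp sp; apply/polyP => i; rewrite coefD coefXn.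
case: (ltngtP i m) => hi.
- by rewrite (coef_rVpoly_ord _ (Ordinal hi)) mxE add0r.
- by rewrite !nth_default ?addr0 ?sp // (leq_trans (size_poly _ _)) // ltnW.
- by rewrite hi -[m in RHS]/(m.+1.-1) -sp -lead_coefE (monicP mp) nth_default ?addr0 // size_poly.
Qed.

Lemma monic_of_coef q (i : 'I_m) : (monic_of q)`_i = q 0 i.
Proof. by rewrite coefD coefXn ltn_eqF // add0r coef_rVpoly_ord. Qed.

Lemma size_eo_poly e o : (size (eo_poly e o) <= m.*2)%N.
Proof.
apply/leq_sizeP => j hj; rewrite coefD coefMX !coef_evp.
have z (v : 'rV[K]_m) i : (m <= i)%N -> (rVpoly v)`_i = 0.
  by move=> hi; rewrite nth_default // (leq_trans (size_poly _ _)).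
case: j hj => [|j] hj /=; first by rewrite addr0 z //; lia.
by case: ifP => h1; case: ifP => h2; rewrite ?z ?addr0 //; lia.
Qed.

Lemma eo_polyK p : (size p <= m.*2)%N -> eo_poly (\row_i p`_i.*2) (\row_i p`_i.*2.+1) = p.
Proof.
move=> sp; rewrite [RHS]poly_evenodd /eo_poly; congr (evp _ + evp _ * _); apply/polyP=> i;
  rewrite ?coef_even_poly ?coef_odd_poly; case: (ltnP i m) => hi;
  by rewrite ?(coef_rVpoly_ord _ (Ordinal hi)) ?mxE //
    !nth_default // ?(leq_trans sp) ?(leq_trans (size_poly _ _)) //; lia.
Qed.

Lemma eo_poly_coef e o (i : 'I_m) :
  (eo_poly e o)`_i.*2 = e 0 i /\ (eo_poly e o)`_i.*2.+1 = o 0 i.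
Proof.
by rewrite -coef_even_poly -coef_odd_poly even_evp odd_evp !coef_rVpoly_ord.
Qed.

Lemma f_neq0 : f != 0. Proof. exact: monic_neq0 (ff_monic F). Qed.

Lemma num_size e o : (size (mu1%:P + f * eo_poly e o)%R <= n)%N.
Proof.
have r0 : (0 < n)%N by [].
apply: (leq_trans (size_polyD _ _)); rewrite geq_max (leq_trans (size_polyC_leq1 _)) //=.
have [->|b0] := eqVneq (eo_poly e o) 0; first by rewrite mulr0 size_poly0.
rewrite size_mul ?f_neq0 // (ff_size F) (ff_dim F).
by rewrite addSn /= addnC leq_add2r size_eo_poly.
Qed.

Lemma sum_of_char q : char_poly (sum_of q) = evp (monic_of q) * f.
Proof.
have mq := monic_of_monic q.
apply: char_compmx; first by rewrite monicMl ?evp_monic // (ff_monic F).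
rewrite size_mul ?f_neq0 ?monic_neq0 ?evp_monic // size_evp ?monic_neq0 //.
by rewrite monic_of_size (ff_size F) (ff_dim F) /= addnS.
Qed.

(** Stability of the ideal of q(u^2) f follows from that of the ideal of f, so the operator
    with the prescribed image of 1 exists; its square is then a matter of the cyclic vector
    and its trace is computed on K[u]/(f). *)
Lemma pair_of_spectral q e o : monic_of q %| psi (rVpoly e) (rVpoly o) ->
  spectral_pair mu1 mu2 t1 t2 (pair_of q e o).
Proof.
move=> hpsi; set S := sum_of q.
have cS : companion S := @compmx_companion _ _ _.
set a := mu1%:P + f * eo_poly e o.
have chiE : char_poly S = evp (monic_of q) * f := sum_of_char q.
have fact : f %| act d a f := ff_act F _.
have cact : char_poly S %| act d a (char_poly S).
  by rewrite chiE actMevp dvdp_mul2l // monic_neq0 // evp_monic // monic_of_monic.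
rewrite /pair_of -/S -/a; set A := actmx d S a.
have AS : A *m S + S *m A = S *m S + d%:M by apply: actmx_intertwine.
have aE : cpoly (col 0 A) = a by apply: col0_actmx => //; apply: num_size.
have AA : A *m A = (mu1 ^+ 2)%:M.
  apply/(act_sqr_mx _ cS AS); rewrite aE chiE.
  have [g [k [k0 _]]] := ff_eqn F (rVpoly e) (rVpoly o).
  rewrite -/(eo_poly e o) -/a /= => ->.
  by rewrite mulrC dvdp_mul2l ?f_neq0 // dvdp_mull // dvdp_evp.
have tA : \tr A = t1.
  apply/(ff_trace F cS AS (monic_of_monic q) (monic_of_size q) chiE); rewrite aE //.
  by rewrite addrC addKr dvdp_mulr.
split; rewrite /= ?[A + _]addrC ?subrK //; split.
  exact/(sqr_sub_mx _ _ AA).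
rewrite linearB /= tA.
have := char_poly_trace S (ltn0Sn n'); rewrite /= chiE (ff_top F) ?monic_of_monic ?monic_of_size //.
by move/oppr_inj => <-; rewrite addrC addKr.
Qed.

(** The congruence modulo q comes from A^2 = mu1^2: the cofactor g of f in [ff_eqn] has a
    constant nonzero odd part, so if q(u^2) divides g psi(u^2), then q divides psi, as one
    sees in the odd component. *)
Lemma spectral_pairP AB : spectral_pair mu1 mu2 t1 t2 AB ->
  [/\ monic_of (pair_den AB) %| psi (rVpoly (pair_even AB)) (rVpoly (pair_odd AB)),
      char_poly (AB.1 + AB.2) = evp (monic_of (pair_den AB)) * f,
      pair_num AB = eo_poly (pair_even AB) (pair_odd AB) &
      pair_of (pair_den AB) (pair_even AB) (pair_odd AB) = AB].
Proof.
case: AB => A B [] /= cS [AA tA] [BB tB]; set S := A + B in cS *.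
have SA : B = S - A by rewrite /S addrC addKr.
have AS : A *m S + S *m A = S *m S + d%:M.
  by apply/(sqr_sub_mx _ _ AA); rewrite -SA.
set chi := char_poly S.
pose a := cpoly (col 0 A).
have c1 : chi %| act d a chi.
  by rewrite -cvec_eq0 // -(act_cvec _ cS AS) (_ : cvec S chi = 0) ?mulmx0 //;
    apply/eqP; rewrite cvec_eq0.
have c2 : chi %| act d a a - (mu1 ^+ 2)%:P by apply/(act_sqr_mx _ cS AS).
have schi : size chi = n.+1 by rewrite size_char_poly.
have top : chi`_n' = - (t1 + t2).
  by rewrite -[n']/(n.-1) char_poly_trace // linearD /= tA tB.
have [q [mq sq chiE]] := ff_char F (char_poly_monic S) schi top c1 c2.
have fact : f %| act d a f.
  by move: c1; rewrite /chi chiE actMevp dvdp_mul2l // monic_neq0 // evp_monic.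
have fa : f %| a - mu1%:P by apply/(ff_trace F cS AS mq sq chiE fact).
have [k k0 kE] := ff_odd F.
have qE : monic_of (pair_den (A, B)) = q.
  rewrite -[RHS]monic_ofK //; congr monic_of; apply/rowP => i; rewrite mxE [RHS]mxE -/S.
  have f1 : f`_1 = k by rewrite -[1%N]/(0.*2.+1) -coef_odd_poly kE coefC.
  have hi : (i.*2.+1 < n)%N.
    by rewrite (ff_dim F); have := ltn_ord i; clear; lia.
  rewrite mulNr -mulrN -(coef_char_poly_companion (inord i.*2.+1) cS) inordK // -/chi f1.
  have -> : chi`_i.*2.+1 = k * q`_i.
    rewrite -coef_odd_poly /chi chiE {1}(poly_evenodd f) kE mulrDr mulrA -!evpM odd_evp.
    by rewrite coefMC mulrC.
  by rewrite mulrA mulVf ?mul1r.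
have numE : a = mu1%:P + f * pair_num (A, B).
  by rewrite mulrC divpK // addrC subrK.
have snum : (size (pair_num (A, B)) <= m.*2)%N.
  rewrite /pair_num size_divp ?f_neq0 // (ff_size F) /= leq_subLR addnC -(ff_dim F).
  apply: (leq_trans (size_polyD _ _)); rewrite geq_max size_polyN size_cpoly.
  by rewrite (leq_trans (size_polyC_leq1 _)).
have eoE : pair_num (A, B) = eo_poly (pair_even (A, B)) (pair_odd (A, B)).
  by rewrite eo_polyK.
split=> //.
- rewrite qE.
  have [g [k' [k0' gE]]] := ff_eqn F (rVpoly (pair_even (A, B))) (rVpoly (pair_odd (A, B))).
  rewrite -/(eo_poly _ _) -eoE -numE /= => E.
  move: c2; rewrite E /chi chiE mulrC dvdp_mul2l ?f_neq0 //.
  rewrite {1}(poly_evenodd g) mulrDl mulrAC -!evpM dvdp_evenodd gE => /andP [_].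
  by rewrite mul_polyC dvdpZr.
- by rewrite qE.
- rewrite /pair_of /sum_of qE -chiE -(compmxE cS) -eoE -numE.
  by rewrite -(actmxE cS AS) -SA.
Qed.

(** The three parameters are read off from the characteristic polynomial and the image of 1. *)
Lemma pair_ofK q e o : monic_of q %| psi (rVpoly e) (rVpoly o) ->
  [/\ pair_den (pair_of q e o) = q, pair_even (pair_of q e o) = e &
      pair_odd (pair_of q e o) = o].
Proof.
move=> h; have [_ h1 h2 _] := spectral_pairP (pair_of_spectral h).
have hn : pair_num (pair_of q e o) = eo_poly e o.
  rewrite /pair_num /pair_of /= col0_actmx ?num_size //; last exact: compmx_companion.
  by rewrite addrC addKr mulKp ?f_neq0.
split.
- have : evp (monic_of (pair_den (pair_of q e o))) * f = evp (monic_of q) * f.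
    by rewrite -h1 -sum_of_char /pair_of /= addrC subrK.
  move/(mulIf f_neq0)/evp_inj => E; apply/rowP => i.
  by rewrite -!monic_of_coef E.
- by apply/rowP => i; rewrite mxE hn (eo_poly_coef e o i).1.
- by apply/rowP => i; rewrite mxE hn (eo_poly_coef e o i).2.
Qed.

End Spectral.

(** * The two families *)

Section Instances.
Variables (K : numFieldType) (m : nat) (mu1 mu2 : K).
Hypothesis mu1_neq0 : mu1 != 0.
Local Notation d := (mu1 ^+ 2 - mu2 ^+ 2).

(** The equation x y^2 - z^2 + 1/4 + (mu1 - mu2) y = 0 for y = o and z = e - 1/2. *)
Definition D1_eqn (e o : {poly K}) : {poly K} :=
  'X * o ^+ 2 - e ^+ 2 + e + (mu1 - mu2)%:P * o.

(** The equation of the surface, for t = e and w = o. *)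
Definition D0_eqn (e o : {poly K}) : {poly K} := e ^+ 2 - 'X * o ^+ 2 + o.

Let c := mu1 + mu2.
Let f1 : {poly K} := 'X - c%:P.
Let f0 : {poly K} := 'X^2 + - (2 * mu1) *: 'X + d%:P.

Lemma evenodd_linear (u : K) : 'X + u%:P = evp u%:P + evp 1 * 'X.
Proof. by rewrite evpC evp1 mul1r addrC. Qed.

Lemma evenodd_quadratic (u v : K) : 'X^2 + u *: 'X + v%:P = evp ('X + v%:P) + evp u%:P * 'X.
Proof. by rewrite evpD evpX !evpC mul_polyC addrAC. Qed.

(** Here K[u]/(f) is a line, on which A is the scalar a(mu1 + mu2); so the trace condition
    is f | a - mu1. *)
Lemma D1_factor : @fixed_factor K m (2 * m) mu1 mu2 mu1 mu2 f1 1 D1_eqn.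
Proof.
have fE : f1 = evp (- c%:P) + evp 1 * 'X by rewrite /f1 -polyCN -evenodd_linear polyCN.
have actf a : act d a f1 = 'X^2 + d%:P - ('X + c%:P) * a.
  rewrite fE act_evenodd evpN evpC evp1; ring.
split.
- by rewrite mul2n addn1.
- exact: size_XsubC.
- exact: monicXsubC.
- by exists 1; rewrite ?oner_eq0 // fE odd_evp.
- move=> b; rewrite actf; apply/dvdpP; exists ('X + mu2%:P - ('X + c%:P) * b).
  by rewrite /f1 /c !(rmorphB, rmorphD, rmorphXn) /=; ring.
(* f = u - c, and the cofactor u + c is - f(-u) *)
- move=> e o; exists ('X + c%:P), 1; split; rewrite ?oner_eq0 //.
    by rewrite evenodd_linear odd_evp.
  move=> a.
  have -> : a = evp (mu1%:P - c%:P * e + 'X * o) + evp (e - c%:P * o) * 'X.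
    rewrite /a /f1 !(evpM, evpXn, evpD, evpN, evpC, evpX); ring.
  rewrite act_evenodd /D1_eqn /f1 /c.
  rewrite !(evpM, evpXn, evpD, evpN, evpC, evpX, rmorphB, rmorphD, rmorphXn) /=.
  ring.
- by move=> q mq sq; rewrite mul2n (coef_evpM_top mq sq).1.
- move=> chi a d0 mchi schi tr h1 h2.
  by apply: (linear_spectral_factor (a := a)) => //; rewrite ?schi ?mul2n // -tr mul2n.
- move=> S A q d0 a cS h mq sq chiE _.
  rewrite (mxtrace_act_linear cS h mq sq chiE) -/a.
  by rewrite dvdp_XsubCl rootE !hornerE subr_eq0; split=> [->|/eqP].
Qed.

(** On the plane K[u]/(f) the trace of A is 2 mu1 (1 - a_1), where a_1 is the coefficient of
    u in a modulo f.  The trace condition kills a_1, and the stability of the ideal of f,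
    which amounts to f | u (a - mu1), then forces a = mu1 modulo f. *)
Lemma D0_factor : @fixed_factor K m (2 * m).+1 mu1 mu2 (2 * mu1) 0 f0 2 D0_eqn.
Proof.
have n2 : 2 * mu1 != 0 by rewrite mulf_neq0 // pnatr_eq0.
have fE : f0 = evp ('X + d%:P) + evp (- (2 * mu1)%:P) * 'X.
  by rewrite /f0 evenodd_quadratic polyCN.
have fE' : f0 = 'X^2 - (2 * mu1)%:P * 'X + d%:P by rewrite /f0 -mul_polyC polyCN mulNr.
have actf a : act d a f0 = 2 * mu1%:P * 'X * (a - mu1%:P) + (a - mu1%:P) * ('X^2 + d%:P)
    - mu1%:P * f0.
  rewrite [in LHS]fE act_evenodd fE' evpD evpN evpX !evpC !polyCM; ring.
have sf : size f0 = 3 := size_quadratic _ _.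
split.
- by rewrite mul2n addn2.
- exact: size_quadratic.
- by rewrite monicE lead_coefE size_quadratic /= !coefD coefZ coefX coefXn coefC /= mulr0 !addr0.
- by exists (- (2 * mu1)); rewrite ?oppr_eq0 // fE odd_evp polyCN.
- move=> b; rewrite actf; apply/dvdpP.
  exists (b * ('X^2 + d%:P + 2 * mu1%:P * 'X) - mu1%:P); ring.
(* the cofactor is f(-u) *)
- move=> e o; exists ('X^2 + (2 * mu1) *: 'X + d%:P), (2 * mu1); split => //.
    by rewrite evenodd_quadratic odd_evp.
  move=> a.
  have -> : a = evp (mu1%:P + ('X + d%:P) * e - (2 * mu1)%:P * 'X * o) +
                evp (('X + d%:P) * o - (2 * mu1)%:P * e) * 'X.
    rewrite /a fE' !(evpM, evpXn, evpD, evpN, evpC, evpX); ring.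
  rewrite act_evenodd /D0_eqn fE' -mul_polyC.
  rewrite !(evpM, evpXn, evpD, evpN, evpC, evpX, rmorphB, rmorphD, rmorphXn, rmorphM) /=.
  ring.
- by move=> q mq sq; rewrite mul2n (coef_evpM_top mq sq).2 addr0.
- move=> chi a d0 mchi schi tr h1 h2.
  by rewrite addr0 mul2n in tr schi *; apply: (quadratic_spectral_factor (a := a)).
- move=> S A q d0 a cS h mq sq chiE fact.
  rewrite (mxtrace_act_quadratic cS h mq sq chiE) -/a -/f0.
  have fX : f0 %| 'X * (a - mu1%:P).
    have : f0 %| (4 * mu1) *: ('X * (a - mu1%:P)).
      have -> : (4 * mu1) *: ('X * (a - mu1%:P)) =
         act d a f0 + (mu1%:P - a + mu1%:P) * f0.
        rewrite actf fE' -!mul_polyC !polyCM; ring.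
      by rewrite dvdp_add // dvdp_mull.
    by rewrite dvdpZr // mulf_neq0 // pnatr_eq0.
  have aE : a %% f0 = ((a %% f0)`_0)%:P + (a %% f0)`_1 *: 'X.
    apply/polyP => i; rewrite coefD coefC coefZ coefX.
    case: i => [|[|i]] /=; rewrite ?mulr0 ?addr0 ?mulr1 ?add0r //.
    have := ltn_modp a f0; rewrite -size_poly_gt0 sf /= => hs.
    by rewrite nth_default //; apply: (leq_trans (_ : _ <= 2)%N) => //; rewrite -ltnS.
  split=> [tr|fa].
    have b0 : (a %% f0)`_1 = 0.
      have : 2 * mu1 * (a %% f0)`_1 = 0.
        have -> : 2 * mu1 * (a %% f0)`_1 = 2 * mu1 - 2 * mu1 * (1 - (a %% f0)`_1) by ring.
        by rewrite tr subrr.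
      by move/eqP; rewrite mulf_eq0 (negbTE n2) /= => /eqP.
    rewrite b0 scale0r addr0 in aE.
    have : f0 %| 'X * ((a %% f0)`_0 - mu1)%:P.
      have -> : 'X * ((a %% f0)`_0 - mu1)%:P = 'X * (a - mu1%:P) - 'X * (a %/ f0) * f0.
        have -> : ((a %% f0)`_0 - mu1)%:P = a - a %/ f0 * f0 - mu1%:P.
          by rewrite polyCB -aE {2}(divp_eq a f0) [_ + a %% f0]addrC addrK.
        by ring.
      by rewrite dvdp_sub // dvdp_mull.
    rewrite mulrC mul_polyC; have [/eqP|c0] := eqVneq ((a %% f0)`_0 - mu1) 0.
      rewrite subr_eq0 => /eqP al _.
      by rewrite {1}(divp_eq a f0) aE al addrK dvdp_mull.
    rewrite dvdpZr // => /dvdp_leq; rewrite polyX_eq0 sf size_polyX => H.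
    by have := H isT.
  have -> : a %% f0 = mu1%:P.
    rewrite -[a](subrK mu1%:P) modpD (modp_eq0 fa) add0r modp_small // sf.
    by rewrite (leq_trans _ (_ : 2 <= 3)%N) // ltnS size_polyC_leq1.
  by rewrite coefC subr0 mulr1.
Qed.

End Instances.

(** * Polynomial functions and morphisms of prevarieties *)

Section PolyFun.
Local Open Scope classical_set_scope.
Variables (K : fieldType) (T : Type) (S : set (T -> K)).
Implicit Types f g : T -> K.

Lemma eq_poly_fun f g : (forall t, f t = g t) -> poly_fun S f -> poly_fun S g.
Proof. by move=> fg; rewrite (_ : g = f) //; apply/funext => t. Qed.

Lemma poly_fun_scale c f : poly_fun S f -> poly_fun S (fun t => c * f t).
Proof. by move=> pf; apply: poly_mul => //; apply: poly_cst. Qed.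

Lemma poly_fun_opp f : poly_fun S f -> poly_fun S (fun t => - f t).
Proof. by move/(poly_fun_scale (-1)); apply: eq_poly_fun => t; rewrite mulN1r. Qed.

Lemma poly_fun_sub f g : poly_fun S f -> poly_fun S g -> poly_fun S (fun t => f t - g t).
Proof. by move=> pf pg; apply: poly_add => //; apply: poly_fun_opp. Qed.

Lemma poly_fun_sum (I : Type) (r : seq I) (P : pred I) (F : I -> T -> K) :
  (forall i, P i -> poly_fun S (F i)) -> poly_fun S (fun t => \sum_(i <- r | P i) F i t).
Proof.
move=> pF; elim: r => [|i r IH].
  by apply: (@eq_poly_fun (fun=> 0)) => [t|]; [rewrite big_nil | apply: poly_cst].
case Pi: (P i).
  apply: (@eq_poly_fun (fun t => F i t + \sum_(i <- r | P i) F i t)) => [t|].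
    by rewrite big_cons Pi.
  by apply: poly_add => //; apply: pF.
by apply: eq_poly_fun IH => t; rewrite big_cons Pi.
Qed.

Lemma poly_fun_prod (I : Type) (r : seq I) (P : pred I) (F : I -> T -> K) :
  (forall i, P i -> poly_fun S (F i)) -> poly_fun S (fun t => \prod_(i <- r | P i) F i t).
Proof.
move=> pF; elim: r => [|i r IH].
  by apply: (@eq_poly_fun (fun=> 1)) => [t|]; [rewrite big_nil | apply: poly_cst].
case Pi: (P i).
  apply: (@eq_poly_fun (fun t => F i t * \prod_(i <- r | P i) F i t)) => [t|].
    by rewrite big_cons Pi.
  by apply: poly_mul => //; apply: pF.
by apply: eq_poly_fun IH => t; rewrite big_cons Pi.
Qed.

Lemma poly_fun_exp k f : poly_fun S f -> poly_fun S (fun t => f t ^+ k).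
Proof.
move=> pf; have := @poly_fun_prod _ (index_enum 'I_k) xpredT (fun=> f) (fun _ _ => pf).
by apply: eq_poly_fun => t; rewrite prodr_const card_ord.
Qed.

Definition poly_mx m n (M : T -> 'M[K]_(m, n)) : Prop :=
  forall i j, poly_fun S (fun t => M t i j).

Lemma poly_mx_cst m n (M : 'M[K]_(m, n)) : poly_mx (fun=> M).
Proof. by move=> i j; apply: poly_cst. Qed.

Lemma poly_mx_add m n (M N : T -> 'M[K]_(m, n)) :
  poly_mx M -> poly_mx N -> poly_mx (fun t => M t + N t).
Proof.
move=> pM pN i j; apply: eq_poly_fun (poly_add (pM i j) (pN i j)) => t.
by rewrite mxE.
Qed.

Lemma poly_mx_scale m n f (M : T -> 'M[K]_(m, n)) :
  poly_fun S f -> poly_mx M -> poly_mx (fun t => f t *: M t).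
Proof.
move=> pf pM i j; apply: eq_poly_fun (poly_mul pf (pM i j)) => t.
by rewrite mxE.
Qed.

Lemma poly_mx_opp m n (M : T -> 'M[K]_(m, n)) : poly_mx M -> poly_mx (fun t => - M t).
Proof.
move=> pM i j; apply: eq_poly_fun (poly_fun_opp (pM i j)) => t.
by rewrite mxE.
Qed.

Lemma poly_mx_mul m n p (M : T -> 'M[K]_(m, n)) (N : T -> 'M[K]_(n, p)) :
  poly_mx M -> poly_mx N -> poly_mx (fun t => M t *m N t).
Proof.
move=> pM pN i j.
have := @poly_fun_sum _ (index_enum 'I_n) xpredT (fun k t => M t i k * N t k j)
  (fun k _ => poly_mul (pM i k) (pN k j)).
by apply: eq_poly_fun => t; rewrite mxE.
Qed.

Lemma poly_mx_sum m n (I : Type) (r : seq I) (P : pred I) (F : I -> T -> 'M[K]_(m, n)) :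
  (forall i, P i -> poly_mx (F i)) -> poly_mx (fun t => \sum_(i <- r | P i) F i t).
Proof.
move=> pF i j.
have := @poly_fun_sum _ r P (fun k t => F k t i j) (fun k Pk => pF k Pk i j).
by apply: eq_poly_fun => t; rewrite summxE.
Qed.

Lemma poly_mx_exp n k (M : T -> 'M[K]_n.+1) : poly_mx M -> poly_mx (fun t => M t ^+ k).
Proof.
move=> pM; elim: k => [|k IH]; first exact: poly_mx_cst.
have -> : (fun t => M t ^+ k.+1) = (fun t => M t *m M t ^+ k).
  by apply/funext => t; rewrite exprS.
exact: poly_mx_mul.
Qed.

Lemma poly_mx_horner n k (M : T -> 'M[K]_n.+1) (v : T -> 'rV[K]_k) :
  poly_mx M -> poly_mx v -> poly_mx (fun t => horner_mx (M t) (rVpoly (v t))).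
Proof.
move=> pM pv.
have -> : (fun t => horner_mx (M t) (rVpoly (v t))) =
    (fun t => \sum_(i < k) v t 0 i *: M t ^+ i).
  by apply/funext => t; rewrite horner_rVpoly mulmx_sum_row linear_sum /=;
    apply: eq_bigr => i _; rewrite linearZ /= rowK mxvecK.
by apply: poly_mx_sum => i _; apply: poly_mx_scale (poly_mx_exp _ _).
Qed.

Lemma poly_fun_det n (M : T -> 'M[K]_n) : poly_mx M -> poly_fun S (fun t => \det (M t)).
Proof.
move=> pM; apply: poly_fun_sum => s _.
by apply: poly_fun_scale; apply: poly_fun_prod => i _.
Qed.

Lemma poly_mx_adj n (M : T -> 'M[K]_n) : poly_mx M -> poly_mx (fun t => \adj (M t)).
Proof.
move=> pM i j; apply: (@eq_poly_fun (fun t => cofactor (M t) j i)) => [t|].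
  by rewrite mxE.
apply: poly_fun_scale; apply: poly_fun_det => k l.
by apply: eq_poly_fun (pM (lift j k) (lift i l)) => t; rewrite !mxE.
Qed.

End PolyFun.

Lemma poly_fun_comp (K : fieldType) (T U : Type) (S : set (T -> K)) (S' : set (U -> K))
    (theta : T -> U) f :
  (forall g, S' g -> poly_fun S (g \o theta)) -> poly_fun S' f -> poly_fun S (f \o theta).
Proof.
move=> h; elim=> [c|g /h //|g1 g2 _ h1 _ h2|g1 g2 _ h1 _ h2].
- exact: poly_cst.
- exact: poly_add.
- exact: poly_mul.
Qed.

Section Criterion.
Local Open Scope classical_set_scope.
Variables (K : fieldType) (V W : prevariety K) (phi : ambient V -> ambient W).

(** Functions of the form g / h^k with a common h are stable under sums and products, so it
    suffices to write the coordinates in this form; the locus where h does not vanish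
    provides the neighbourhood. *)
Lemma morphism_locally_rational :
  (forall t, points V t -> points W (phi t)) ->
  (forall t j, points V t -> dom W j (phi t) -> exists i h,
     [/\ dom V i t, poly_fun (coords V i) h, h t != 0,
         forall s, points V s -> dom V i s -> h s != 0 -> dom W j (phi s) &
         forall f, coords W j f -> exists g k, poly_fun (coords V i) g /\
           forall s, points V s -> dom V i s -> h s != 0 -> f (phi s) = g s / h s ^+ k]) ->
  variety_morphism phi.
Proof.
move=> phiP loc; split=> // U [UW opU].
have local_rational j t : points V t -> dom W j (phi t) -> exists i h,
     [/\ dom V i t, poly_fun (coords V i) h, h t != 0,
         forall s, points V s -> dom V i s -> h s != 0 -> dom W j (phi s) &
         forall f, poly_fun (coords W j) f -> exists g k, poly_fun (coords V i) g /\
           forall s, points V s -> dom V i s -> h s != 0 -> f (phi s) = g s / h s ^+ k].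
  move=> Vt jt; have [i [h [it ph ht dh ch]]] := loc t j Vt jt.
  exists i, h; split=> // f; elim=> [c|g /ch //|f1 f2 _ [g1 [k1 [p1 e1]]] _ [g2 [k2 [p2 e2]]]
      |f1 f2 _ [g1 [k1 [p1 e1]]] _ [g2 [k2 [p2 e2]]]].
  - exists (fun=> c), 0; split=> [|s _ _ _]; first exact: poly_cst.
    by rewrite expr0 divr1.
  - exists (fun s => g1 s * h s ^+ k2 + g2 s * h s ^+ k1), (k1 + k2)%N.
    split=> [|s Vs si hs].
      by apply: poly_add; apply: poly_mul => //; apply: poly_fun_exp.
    by rewrite e1 // e2 // addf_div ?expf_neq0 // exprD.
  - exists (fun s => g1 s * g2 s), (k1 + k2)%N; split=> [|s Vs si hs]; first exact: poly_mul.
    by rewrite e1 // e2 // exprD mulf_div.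
split.
  split=> [t []//|t [Vt Ut]].
  have [j [H [pH jt Ht HU]]] := opU _ Ut.
  have [i [h [it ph ht dh ch]]] := local_rational j t Vt jt.
  have [g [k [pg e]]] := ch H pH.
  exists i, (fun s => h s * g s); split=> //.
  - exact: poly_mul.
  - by apply: mulf_neq0 => //; move: Ht; rewrite e //; apply: contraNneq => ->; rewrite mul0r.
  - move=> s Vs si; rewrite mulf_eq0 negb_or => /andP [hs gs]; split=> //.
    apply: HU; [exact: phiP|exact: dh|].
    by rewrite e // mulf_neq0 // invr_eq0 expf_neq0.
move=> f rf t [Vt Ut].
have [j [g1 [g2 [pg1 pg2 jt g2t fE]]]] := rf _ Ut.
have [i [h [it ph ht dh ch]]] := local_rational j t Vt jt.
have [G1 [k1 [p1 e1]]] := ch _ pg1.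
have [G2 [k2 [p2 e2]]] := ch _ pg2.
exists i, (fun s => h s * (G1 s * h s ^+ k2)), (fun s => h s * (G2 s * h s ^+ k1)); split=> //.
- by apply: poly_mul => //; apply: poly_mul => //; apply: poly_fun_exp.
- by apply: poly_mul => //; apply: poly_mul => //; apply: poly_fun_exp.
- rewrite !mulf_neq0 ?expf_neq0 //.
  by move: g2t; rewrite e2 //; apply: contraNneq => ->; rewrite mul0r.
- move=> s [Vs Us] si; rewrite mulf_eq0 negb_or => /andP [hs].
  rewrite mulf_eq0 negb_or => /andP [gs _].
  rewrite /= fE //; last 2 first.
  - exact: dh.
  - by rewrite e2 // mulf_neq0 // invr_eq0 expf_neq0.
  rewrite e1 // e2 //; have := expf_neq0 k1 hs; have := expf_neq0 k2 hs.
  move: (h s ^+ k1) (h s ^+ k2) => u v v0 u0.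
  by field; rewrite u0 v0 gs hs.
Qed.
End Criterion.

(** * Bases modulo an ideal *)

Section BasisMod.
Local Open Scope classical_set_scope.
Variables (K : fieldType) (N m : nat) (I : set (mpoly N K)).
Local Notation P := (mpoly N K).
Hypothesis idI : is_ideal I.
Implicit Types (r s : P) (b w : 'I_m -> P).

Lemma ideal_add r s : I r -> I s -> I (r + s). Proof. by case: idI => _ h _; exact: h. Qed.
Lemma ideal_mull r s : I s -> I (r * s). Proof. by case: idI => _ _ h; exact: h. Qed.
Lemma ideal0 : I 0. Proof. by case: idI. Qed.
Lemma ideal_opp r : I r -> I (- r). Proof. by rewrite -mulN1r; exact: ideal_mull. Qed.
Lemma ideal_sub r s : I r -> I s -> I (r - s).
Proof. by move=> hr hs; apply: ideal_add => //; apply: ideal_opp. Qed.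
Lemma ideal_scale c r : I r -> I (c *: r).
Proof. by rewrite -mul_mpolyC; exact: ideal_mull. Qed.
Lemma ideal_eqm r s : I (r - s) -> I r <-> I s.
Proof.
move=> h; split=> [hr|hs]; last by rewrite -(subrK s r); apply: ideal_add.
by rewrite -[s](subKr r); apply: ideal_sub.
Qed.

Lemma coord_modP b r : basis_mod I b ->
  I (r - \sum_i coord_mod b r I 0 i *: b i).
Proof.
move=> bb; have [c [hc _]] := bb r.
exact: (@xgetPex _ 0 [set c : 'rV[K]_m | I (r - \sum_i c 0 i *: b i)] (ex_intro _ c hc)).
Qed.

Lemma coord_mod_unique b r (c : 'rV[K]_m) : basis_mod I b ->
  I (r - \sum_i c 0 i *: b i) -> coord_mod b r I = c.
Proof.
by move=> bb hc; have [e [_ u]] := bb r; rewrite -(u _ hc); apply/esym/u/coord_modP.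
Qed.

Lemma coord_modD b r s : basis_mod I b -> coord_mod b (r + s) I = coord_mod b r I + coord_mod b s I.
Proof.
move=> bb; apply: coord_mod_unique => //.
rewrite (eq_bigr _ (fun i _ => congr2 *:%R (mxE _ _ _ _) (erefl _))).
under eq_bigr do rewrite scalerDl.
by rewrite big_split opprD addrACA; apply: ideal_add; apply: coord_modP.
Qed.

Lemma coord_modZ b a r : basis_mod I b -> coord_mod b (a *: r) I = a *: coord_mod b r I.
Proof.
move=> bb; apply: coord_mod_unique => //.
under eq_bigr do rewrite mxE -scalerA.
by rewrite -scaler_sumr -scalerBr; apply: ideal_scale; apply: coord_modP.
Qed.

Lemma coord_mod_eq0 b r : basis_mod I b -> coord_mod b r I = 0 <-> I r.
Proof.
move=> bb; split=> [h|h].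
  by have := coord_modP r bb; rewrite h big1 ?subr0 // => i _; rewrite mxE scale0r.
by apply: coord_mod_unique => //; rewrite big1 ?subr0 // => i _; rewrite mxE scale0r.
Qed.

Lemma coord_mod_comb b w (c : 'rV[K]_m) : basis_mod I b ->
  coord_mod b (\sum_i c 0 i *: w i) I = c *m \matrix_i coord_mod b (w i) I.
Proof.
move=> bb; rewrite mulmx_sum_row; elim/big_rec2: _ => [|i x y _ <-].
  by apply/coord_mod_eq0 => //; exact: ideal0.
by rewrite coord_modD // coord_modZ // rowK.
Qed.

(** Congruence modulo I is equality of coordinates in b, so expressing r through w is a
    linear system. *)
Lemma coord_mod_combP b w r (c : 'rV[K]_m) : basis_mod I b ->
  I (r - \sum_i c 0 i *: w i) <-> coord_mod b r I = c *m \matrix_i coord_mod b (w i) I.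
Proof.
move=> bb; rewrite -(coord_mod_eq0 _ bb) -scaleN1r coord_modD // coord_modZ //.
rewrite coord_mod_comb // scaleN1r; split => [/eqP|->]; last by rewrite subrr.
by rewrite subr_eq0 => /eqP.
Qed.

Lemma coord_mod_basis b (j : 'I_m) : basis_mod I b -> coord_mod b (b j) I = delta_mx 0 j.
Proof.
move=> bb; apply: coord_mod_unique => //.
rewrite (bigD1 j) //= big1 ?addr0 => [|i ij]; rewrite !mxE ?(negbTE ij) ?scale0r //.
by rewrite !eqxx scale1r subrr; exact: ideal0.
Qed.

Lemma spanning_basis b w : basis_mod I b ->
  (forall j, exists c : 'rV[K]_m, I (b j - \sum_i c 0 i *: w i)) ->
  (\matrix_i coord_mod b (w i) I) \in unitmx.
Proof.
move=> bb h; set M := \matrix_i _; have /choice [C hC] := h.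
have CM : (\matrix_j C j) *m M = 1%:M.
  apply/row_matrixP => j; rewrite row_mul rowK -(iffLR (coord_mod_combP _ _ _ bb) (hC j)).
  by rewrite coord_mod_basis // row1.
by have [] := mulmx1_unit CM.
Qed.

(** By [coord_mod_combP], unique expression through w is unique solvability of a square linear
    system; a spanning family already gives a one-sided inverse of its matrix. *)
Lemma basis_modP b w : basis_mod I b ->
  basis_mod I w <-> (\matrix_i coord_mod b (w i) I) \in unitmx.
Proof.
move=> bb; split=> [bw|uM r].
  exact: (spanning_basis bb (fun j => ex_intro _ _ (coord_modP (b j) bw))).
exists (coord_mod b r I *m invmx (\matrix_i coord_mod b (w i) I)); split.
  by apply/(coord_mod_combP _ _ _ bb); rewrite mulmxKV.
by move=> c /(coord_mod_combP _ _ _ bb) ->; rewrite mulmxK.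
Qed.

Lemma coord_mod_change b w r : basis_mod I b -> basis_mod I w ->
  coord_mod w r I = coord_mod b r I *m invmx (\matrix_i coord_mod b (w i) I).
Proof.
move=> bb bw; apply: coord_mod_unique => //; apply/(coord_mod_combP _ _ _ bb).
by rewrite mulmxKV //; apply/basis_modP.
Qed.

End BasisMod.

(** * Transverse subschemes are sections *)

Section Sections.
Local Open Scope classical_set_scope.
Variables (K : numFieldType) (N m : nat) (k : 'I_N).
Local Notation P := (mpoly N K).
Implicit Types (r s : P) (I : set P) (q : 'rV[K]_m) (Y : 'I_N -> 'rV[K]_m) (p : {poly K}).

Local Notation proj := (@proj_comorphism K N k).

Lemma projD p1 p2 : proj (p1 + p2) = proj p1 + proj p2.
Proof. by rewrite /proj_comorphism rmorphD. Qed.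
Lemma projM p1 p2 : proj (p1 * p2) = proj p1 * proj p2.
Proof. by rewrite /proj_comorphism rmorphM. Qed.
Lemma projB p1 p2 : proj (p1 - p2) = proj p1 - proj p2.
Proof. by rewrite /proj_comorphism rmorphB. Qed.
Lemma projZ (c : K) p : proj (c *: p) = c *: proj p.
Proof. by rewrite -mul_polyC projM /proj_comorphism horner_algC mulr_algl. Qed.

Definition xpow (i : 'I_m) : P := proj 'X^i.

(** The k-th coordinate of the point of the section over x is x itself, whatever the family
    Y says at k. *)
Definition section_fun Y (l : 'I_N) : {poly K} := if l == k then 'X else rVpoly (Y l).
Definition restrict Y (r : P) : {poly K} := mmap (@polyC K) (section_fun Y) r.

Lemma restrictD Y r s : restrict Y (r + s) = restrict Y r + restrict Y s.
Proof. exact: rmorphD. Qed.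
Lemma restrictB Y r s : restrict Y (r - s) = restrict Y r - restrict Y s.
Proof. exact: rmorphB. Qed.
Lemma restrictM Y r s : restrict Y (r * s) = restrict Y r * restrict Y s.
Proof. exact: rmorphM. Qed.
Lemma restrictZ Y (c : K) r : restrict Y (c *: r) = c *: restrict Y r.
Proof. by rewrite /restrict mmapZ mul_polyC. Qed.
Lemma restrictXn Y r i : restrict Y (r ^+ i) = restrict Y r ^+ i.
Proof. exact: rmorphXn. Qed.
Lemma restrictC Y (c : K) : restrict Y (mpolyC N c) = c%:P.
Proof. by rewrite /restrict mmapC. Qed.
Lemma restrict_var Y l : restrict Y (mpolyX K (mnm1 l)) = section_fun Y l.
Proof. by rewrite /restrict mmapX mmap1U. Qed.

(** The graph of Y is a section of the projection. *)
Lemma restrict_proj Y p : restrict Y (proj p) = p.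
Proof.
elim/poly_ind: p => [|p c IH]; first by rewrite /proj_comorphism rmorph0 /restrict rmorph0.
rewrite projD projM restrictD restrictM IH /proj_comorphism horner_algX horner_algC.
rewrite restrict_var /section_fun eqxx restrictZ -[c%:P]alg_polyC.
by congr (_ + c *: _); apply: rmorph1.
Qed.

Lemma restrict_sum Y (c : 'rV[K]_m) : restrict Y (\sum_i c 0 i *: xpow i) = rVpoly c.
Proof.
rewrite /rVpoly poly_def; elim/big_rec2: _ => [|i x y _ IH]; first exact: rmorph0.
rewrite restrictD IH restrictZ restrict_proj; congr (_ *: _ + _).
by rewrite valK.
Qed.

Lemma projE p : (size p <= m)%N -> proj p = \sum_(i < m) p`_i *: xpow i.
Proof.
move=> sp; rewrite -[in LHS](coefK p) poly_def.
rewrite (big_ord_widen _ (fun i => p`_i *: 'X^i) sp) big_mkcond /=.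
rewrite [LHS]rmorph_sum /=; apply: eq_bigr => i _; rewrite -/(proj _).
case: ifP => [_|/negbT]; first by rewrite projZ.
by rewrite -leqNgt => hi; rewrite nth_default // scale0r [LHS]rmorph0.
Qed.

(** The ideal of the part of the graph of Y lying over the zeros of q. *)
Definition section_ideal q Y : set P := [set r | monic_of q %| restrict Y r].

Lemma section_is_ideal q Y : is_ideal (section_ideal q Y).
Proof.
rewrite /section_ideal; split=> /=.
- by rewrite /restrict rmorph0 dvdp0.
- by move=> a b ha hb; rewrite restrictD dvdp_add.
- by move=> r a ha; rewrite restrictM dvdp_mull.
Qed.

Lemma section_transverse q Y : transverse k (section_ideal q Y).
Proof.
split=> // b; exists (restrict Y b).
by rewrite /section_ideal /= restrictB restrict_proj subrr dvdp0.
Qed.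

Lemma size_mod_monic q p : (size (p %% monic_of q)%R <= m)%N.
Proof.
by have := ltn_modp p (monic_of q); rewrite (monic_neq0 (monic_of_monic q)) monic_of_size ltnS.
Qed.

(** The algebra of functions on the graph is K[x]/(q), with basis 1, ..., x^(m-1). *)
Lemma section_coordP q Y r (c : 'rV[K]_m) :
  section_ideal q Y (r - \sum_i c 0 i *: xpow i) <->
  c = \row_i (restrict Y r %% monic_of q)`_i.
Proof.
have cs : (size (rVpoly c) <= m)%N by exact: size_poly.
rewrite /section_ideal /= restrictB restrict_sum; split=> [h|->].
  have : (restrict Y r) %% monic_of q = rVpoly c.
    rewrite -[restrict Y r](subrK (rVpoly c)) modpD (modp_eq0 h) add0r modp_small //.
    by rewrite monic_of_size ltnS.
  by move=> ->; apply/rowP=> i; rewrite mxE coef_rVpoly_ord.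
rewrite (_ : rVpoly _ = restrict Y r %% monic_of q); last first.
  apply/polyP => i; case: (ltnP i m) => hi.
    by rewrite (coef_rVpoly_ord _ (Ordinal hi)) mxE.
  by rewrite !nth_default ?(leq_trans (size_poly _ _)) ?(leq_trans (size_mod_monic _ _)).
by rewrite {1}(divp_eq (restrict Y r) (monic_of q)) addrK dvdp_mull.
Qed.

Lemma section_basis q Y : basis_mod (section_ideal q Y) xpow.
Proof.
move=> r; exists (\row_i (restrict Y r %% monic_of q)`_i); split; first exact/section_coordP.
by move=> c /section_coordP ->.
Qed.

Lemma section_coord q Y r :
  coord_mod xpow r (section_ideal q Y) = \row_i (restrict Y r %% monic_of q)`_i.
Proof.
by apply: (coord_mod_unique (section_basis q Y)); apply/section_coordP.
Qed.

Definition ideal_den (I : set P) : 'rV[K]_m := - coord_mod xpow (proj 'X^m) I.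
Definition ideal_section (I : set P) (l : 'I_N) : 'rV[K]_m :=
  coord_mod xpow (mpolyX K (mnm1 l)) I.

(** By transversality every class contains a polynomial in x.  The m+1 classes of 1, ..., x^m
    are linearly dependent, so some nonzero h of degree at most m vanishes on the subscheme, and
    reducing modulo h shows that 1, ..., x^(m-1) span. *)
Lemma transverse_basis I (b : 'I_m -> P) : is_ideal I -> basis_mod I b ->
  transverse k I -> basis_mod I xpow.
Proof.
move=> idI bb [_ surj]; apply/(basis_modP idI _ bb).
(* m + 1 vectors in a space of dimension m *)
pose M := \matrix_(i < m.+1) coord_mod b (proj 'X^i) I.
have [v v0 vM] : exists2 v : 'rV_m.+1, v != 0 & v *m M = 0.
  have kn0 : kermx M != 0.
    rewrite kermx_eq0 /row_free neq_ltn; apply/orP; left.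
    by rewrite ltnS rank_leq_col.
  have /rowV0Pn [v /sub_kermxP vM v0] := kn0.
  by exists v.
pose h := rVpoly v.
have h0 : h != 0 by apply: contraNneq v0 => h0; rewrite -[v]rVpolyK -/h h0 linear0.
have Ih : I (proj h).
  apply/(coord_mod_eq0 _ bb); rewrite -vM.
  have -> : proj h = \sum_i v 0 i *: proj 'X^i.
    rewrite /h /rVpoly poly_def [LHS]rmorph_sum /=; apply: eq_bigr => i _.
    by rewrite valK -/(proj _) projZ.
  rewrite mulmx_sum_row; elim/big_rec2: _ => [|i x y _ <-].
    by apply/(coord_mod_eq0 _ bb); exact: ideal0.
  by rewrite (coord_modD idI _ _ bb) (coord_modZ idI _ _ bb) rowK.
apply: (spanning_basis idI bb) => j; have [a Ia] := surj (b j).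
exists (\row_i (a %% h)`_i).
have sa : (size (a %% h)%R <= m)%N.
  have := ltn_modp a h; rewrite h0 => /leq_trans; rewrite -ltnS; apply.
  exact: size_poly.
under eq_bigr do rewrite mxE.
rewrite -(projE sa).
have e : I ((b j - proj (a %% h)) - (b j - proj a)).
  rewrite (_ : _ - _ = proj (a - a %% h)); last by rewrite projB; ring.
  by rewrite {1}(divp_eq a h) addrK projM; apply: (ideal_mull idI).
exact/(ideal_eqm idI e).
Qed.

(** The relation expressing x^m through lower powers generates the ideal of the image,
    since those powers are independent. *)
Lemma ideal_proj I p : is_ideal I -> basis_mod I xpow ->
  I (proj p) <-> monic_of (ideal_den I) %| p.
Proof.
move=> idI bx; set q := monic_of _.
have Iq : I (proj q).
  rewrite /q /monic_of projD (projE (size_poly _ _)).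
  have := coord_modP (proj 'X^m) bx; congr I; congr (_ + _).
  rewrite -sumrN; apply: eq_bigr => i _; rewrite coef_rVpoly_ord mxE scaleNr.
  by [].
have sp : (size (p %% q)%R <= m)%N by exact: size_mod_monic.
have e : I (proj p - proj (p %% q)).
  rewrite -projB {1}(divp_eq p q) addrK projM; exact: (ideal_mull idI).
rewrite (ideal_eqm idI e) -(coord_mod_eq0 _ bx) /dvdp (projE sp).
split=> [h|/eqP ->]; last first.
  apply/(coord_mod_eq0 _ bx); rewrite big1; first exact: ideal0.
  by move=> i _; rewrite coef0 scale0r.
apply/eqP/polyP => i; rewrite coef0; case: (ltnP i m) => hi; last first.
  by rewrite nth_default // (leq_trans sp).
suff : \row_i (p %% q)`_i = 0 :> 'rV[K]_m.
  by move/rowP/(_ (Ordinal hi)); rewrite !mxE.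
rewrite -h; symmetry; apply: (coord_mod_unique bx).
under [X in _ - X]eq_bigr do rewrite mxE.
by rewrite subrr; exact: ideal0.
Qed.

(** On the subscheme every variable is congruent to the polynomial in x giving its
    coordinates, hence so is every polynomial. *)
Lemma ideal_restrict I r : is_ideal I -> basis_mod I xpow ->
  I (r - proj (restrict (ideal_section I) r)).
Proof.
move=> idI bx.
pose G r := I (r - proj (restrict (ideal_section I) r)).
have GM r1 r2 : G r1 -> G r2 -> G (r1 * r2).
  rewrite /G => h1 h2; rewrite restrictM projM; set a := proj _ in h1 *; set b := proj _ in h2 *.
  have -> : r1 * r2 - a * b = r2 * (r1 - a) + a * (r2 - b) by ring.
  by apply: (ideal_add idI); apply: (ideal_mull idI).
have GD r1 r2 : G r1 -> G r2 -> G (r1 + r2).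
  rewrite /G => h1 h2; rewrite restrictD projD opprD addrACA.
  exact: (ideal_add idI).
have G1 : G 1.
  rewrite /G /restrict rmorph1 /proj_comorphism rmorph1 subrr; exact: ideal0.
have Gvar l : G (mpolyX K (mnm1 l)).
  rewrite /G restrict_var /section_fun; case: eqP => [->|_].
    rewrite /proj_comorphism horner_algX subrr; exact: ideal0.
  rewrite projE ?size_poly //.
  under eq_bigr do rewrite coef_rVpoly_ord.
  exact: coord_modP.
have GX r1 i : G r1 -> G (r1 ^+ i).
  by move=> h; elim: i => [|i IH]; rewrite ?expr0 // exprS; apply: GM.
rewrite -/(G r); elim/mpolyind: r => [|c mo p _ _ IH].
  rewrite /G /restrict rmorph0 /proj_comorphism rmorph0 subrr; exact: ideal0.
apply: GD => //.
have Gmo : G (mpolyX K mo).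
  rewrite mpolyXE_id; elim/big_rec: _ => // i x _ hx.
  by apply: GM => //; apply: GX.
by rewrite /G restrictZ projZ -scalerBr; apply: (ideal_scale idI).
Qed.

Lemma ideal_section_ideal I : is_ideal I -> basis_mod I xpow ->
  section_ideal (ideal_den I) (ideal_section I) = I.
Proof.
move=> idI bx; apply/seteqP; split=> r; rewrite /section_ideal /=.
  by move/(ideal_proj _ idI bx) => h; apply/(ideal_eqm idI (ideal_restrict r idI bx)).
move=> Ir; apply/(ideal_proj _ idI bx).
by apply/(ideal_eqm idI (ideal_restrict r idI bx)).
Qed.

Lemma section_idealK q Y :
  ideal_den (section_ideal q Y) = q /\
  forall l, l != k -> ideal_section (section_ideal q Y) l = Y l.
Proof.
split=> [|l lk].
  rewrite /ideal_den section_coord restrict_proj.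
  have -> : 'X^m %% monic_of q = - rVpoly q.
    symmetry; apply: (@modpP _ _ 1); first by rewrite /monic_of mul1r addrK.
    by rewrite size_polyN monic_of_size ltnS size_poly.
  by apply/rowP => i; rewrite !mxE coefN coef_rVpoly_ord opprK.
rewrite /ideal_section section_coord restrict_var /section_fun (negbTE lk).
rewrite modp_small ?monic_of_size ?ltnS ?size_poly //.
by apply/rowP => i; rewrite mxE coef_rVpoly_ord.
Qed.

End Sections.

(** * Coordinates on the transverse Hilbert scheme *)

Section HilbIso.
Local Open Scope classical_set_scope.
Variables (K : numFieldType) (N m' : nat) (k : 'I_N) (F : mpoly N K).
Local Notation m := m'.+1.
Local Notation P := (mpoly N K).
Local Notation data := ('rV[K]_m * ('I_N -> 'rV[K]_m))%type.

Local Notation xp := (@xpow K N m k).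

Definition data_coords : set (data -> K) :=
  [set f | (exists i, f = fun qY : data => qY.1 0 i) \/
    exists l i, f = fun qY : data => qY.2 l 0 i].

(** Evaluating at a matrix turns the substitution into sums and products of matrices that
    depend polynomially on t. *)
Lemma horner_mx_restrict (T : Type) (S : set (T -> K)) (M : T -> 'M[K]_m)
    (Y : T -> 'I_N -> 'rV[K]_m) (r : P) :
  poly_mx S M -> (forall l, poly_mx S (fun t => Y t l)) ->
  poly_mx S (fun t => horner_mx (M t) (restrict k (Y t) r)).
Proof.
move=> pM pY.
pose X l t : 'M[K]_m := if l == k then M t else horner_mx (M t) (rVpoly (Y t l)).
have pX l : poly_mx S (X l).
  by rewrite /X; case: (l == k) => //; apply: poly_mx_horner.
have -> : (fun t => horner_mx (M t) (restrict k (Y t) r)) =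
   fun t => \sum_(mo <- msupp r) mcoeff mo r *: \prod_(l < N) X l t ^+ mo l.
  apply/funext => t; rewrite /restrict /mmap raddf_sum /=; apply: eq_bigr => mo _.
  rewrite rmorphM /= horner_mx_C -mul_scalar_mx; congr (_ *m _).
  rewrite /mmap1 rmorph_prod /=; apply: eq_bigr => l _.
  by rewrite rmorphXn /= /section_fun /X; case: ifP => // _; rewrite horner_mx_X.
apply: poly_mx_sum => mo _; apply: poly_mx_scale; first exact: poly_cst.
elim: (index_enum _) => [|l s IH].
  have -> : (fun t => \prod_(l <- [::]) X l t ^+ mo l) = fun=> 1%:M :> 'M[K]_m.
    by apply/funext => t; rewrite big_nil.
  exact: poly_mx_cst.
have -> : (fun t => \prod_(l <- l :: s) X l t ^+ mo l) =
   fun t => X l t ^+ mo l *m \prod_(l <- s) X l t ^+ mo l.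
  by apply/funext => t; rewrite big_cons.
by apply: poly_mx_mul => //; apply: poly_mx_exp.
Qed.

(** Multiplication by x on K[x]/(q) is the companion matrix of q, so that coordinates are
    obtained without dividing polynomials. *)
Lemma section_coord_mx (q : 'rV[K]_m) (Y : 'I_N -> 'rV[K]_m) (r : P) :
  coord_mod xp r (section_ideal k q Y) =
  (horner_mx (compmx m' (monic_of q)) (restrict k Y r) *m delta_mx 0 0)^T.
Proof.
set C := compmx _ _.
have chiC : char_poly C = monic_of q.
  by apply: char_compmx; rewrite ?monic_of_monic ?monic_of_size.
rewrite section_coord -chiC; apply/rowP => i.
by rewrite mxE -(cpoly_cvec _ (@compmx_companion _ _ _)) coef_cpoly [RHS]mxE.
Qed.

Definition affine_section (q : 'rV[K]_m) (Y : 'I_N -> 'rV[K]_m) : Prop :=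
  monic_of q %| restrict k Y F.

Lemma section_point q Y : affine_section q Y ->
  points (transverse_hilb F k m) (section_ideal k q Y).
Proof.
move=> h; split; last exact: section_transverse.
split; [exact: section_is_ideal | exact: h | exists xp; exact: section_basis].
Qed.

Lemma hilb_section I : points (transverse_hilb F k m) I ->
  [/\ basis_mod I xp,
      section_ideal k (ideal_den m k I) (ideal_section m k I) = I &
      affine_section (ideal_den m k I) (ideal_section m k I)].
Proof.
move=> [[idI IF [b bb]] tr].
have bx := transverse_basis idI bb tr.
have e := ideal_section_ideal idI bx.
by split=> //; move: IF; rewrite -{1}e.
Qed.

Variables (V : prevariety K) (Q : ambient V -> 'rV[K]_m)
  (Y : ambient V -> 'I_N -> 'rV[K]_m)
  (Psi : 'rV[K]_m -> ('I_N -> 'rV[K]_m) -> ambient V).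
Hypothesis domV : forall i, dom V i = setT.
Hypothesis chartV : chart V.
Hypothesis polyQ : forall i, poly_mx (coords V i) Q.
Hypothesis polyY : forall i l, poly_mx (coords V i) (fun t => Y t l).
Hypothesis polyPsi : forall i f, coords V i f ->
  poly_fun data_coords (fun qY => f (Psi qY.1 qY.2)).
Hypothesis Psi_ext : forall q y y', (forall l, l != k -> y l = y' l) -> Psi q y = Psi q y'.
Hypothesis VP : forall t, points V t -> affine_section (Q t) (Y t) /\ Psi (Q t) (Y t) = t.
Hypothesis PsiP : forall q y, affine_section q y ->
  [/\ points V (Psi q y), Q (Psi q y) = q & forall l, l != k -> Y (Psi q y) l = y l].

Let to_hilb (t : ambient V) : set P := section_ideal k (Q t) (Y t).
Let of_hilb (I : set P) : ambient V := Psi (ideal_den m k I) (ideal_section m k I).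

Lemma section_ideal_ext (q : 'rV[K]_m) (y y' : 'I_N -> 'rV[K]_m) :
  (forall l, l != k -> y l = y' l) ->
  section_ideal k q y = section_ideal k q y' :> set P.
Proof.
move=> h; rewrite /section_ideal; congr mkset; apply/funext => r.
suff -> : restrict k y r = restrict k y' r by [].
rewrite /restrict; congr mmap; apply/funext => l.
by rewrite /section_fun; case: eqP => // /eqP /h ->.
Qed.

(** In the chart of a basis b, the coordinates are those in 1, ..., x^(m-1), which are
    polynomial, times the inverse of the transition matrix; by the cofactor formula its
    determinant is the only denominator, and it vanishes exactly outside the chart. *)
Lemma to_hilb_morphism : @variety_morphism K V (transverse_hilb F k m) to_hilb.
Proof.
apply: morphism_locally_rational => [t Vt|t b Vt bt].
  by apply: section_point; case: (VP Vt).
pose C s := compmx m' (monic_of (Q s)).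
have pC : poly_mx (coords V chartV) C.
  move=> i j; rewrite /C; case hj: (j.+1 < m)%N.
    by apply: eq_poly_fun (poly_cst _ (i == j.+1 :> nat)%:R) => s; rewrite mxE hj.
  apply: eq_poly_fun (poly_fun_opp (polyQ chartV 0 i)) => s.
  by rewrite mxE hj monic_of_coef.
have pcoord r : poly_mx (coords V chartV) (fun s => coord_mod xp r (to_hilb s)).
  move=> i j; apply: (@eq_poly_fun _ _ _ (fun s =>
      (horner_mx (C s) (restrict k (Y s) r) *m (delta_mx 0 0 : 'cV[K]_m)) j 0)).
    by move=> s; rewrite /to_hilb section_coord_mx (ord1 i) [RHS]mxE.
  have pv : poly_mx (coords V chartV)
      (fun s => horner_mx (C s) (restrict k (Y s) r) *m (delta_mx 0 0 : 'cV[K]_m)).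
    by apply: poly_mx_mul; [apply: horner_mx_restrict => // l; exact: polyY | exact: poly_mx_cst].
  exact: (pv j 0).
pose M s : 'M[K]_m := \matrix_i coord_mod xp (b i) (to_hilb s).
have pM : poly_mx (coords V chartV) M.
  by move=> i j; apply: eq_poly_fun (pcoord (b i) 0 j) => s; rewrite [RHS]mxE.
have bM s : basis_mod (to_hilb s) b <-> \det (M s) != 0.
  rewrite (basis_modP (section_is_ideal _ _ _) _ (section_basis _ _ _)).
  by rewrite unitmxE unitfE.
exists chartV, (fun s => \det (M s)); split.
- by rewrite domV.
- exact: poly_fun_det.
- exact/bM.
- by move=> s _ _ /bM.
- move=> f [r [i ->]].
  exists (fun s => (coord_mod xp r (to_hilb s) *m \adj (M s)) 0 i), 1%N; split.
    by apply: poly_mx_mul => //; apply: poly_mx_adj.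
  move=> s _ _ ds; have /bM bs := ds.
  rewrite (coord_mod_change (section_is_ideal _ _ _) _ (section_basis _ _ _) bs).
  by rewrite -/(M s) /invmx unitmxE unitfE ds -scalemxAr mxE expr1 mulrC.
Qed.

(** Every transverse subscheme lies in the chart of the basis 1, ..., x^(m-1), whose
    coordinates include the coefficients of q and of the section. *)
Lemma of_hilb_morphism : @variety_morphism K (transverse_hilb F k m) V of_hilb.
Proof.
apply: morphism_locally_rational => [I /hilb_section [_ _ h]|I j HI _].
  by case: (PsiP h).
have [bI _ _] := hilb_section HI.
exists xp, (fun=> 1); split=> //.
- exact: poly_cst.
- by move=> *; rewrite domV.
move=> f cf; exists (f \o of_hilb), 0; split; last by move=> *; rewrite expr0 divr1.
apply: (poly_fun_comp (theta := fun I => (ideal_den m k I, ideal_section m k I)) _ (polyPsi cf)).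
move=> g [[i ->]|[l [i ->]]].
  apply: (@eq_poly_fun _ _ _ (fun I => - coord_mod xp (proj_comorphism k 'X^m) I 0 i)).
    by move=> J; rewrite /= /ideal_den mxE.
  by apply: poly_fun_opp; apply: poly_coord; exists (proj_comorphism k 'X^m), i.
by apply: poly_coord; exists (mpolyX K (mnm1 l)), i.
Qed.

(** The graph of Y over q = 0 is the general transverse subscheme, and it determines q and Y up
    to the value of Y at k; so a polynomial parametrization of V by the same data is an
    isomorphism. *)
Lemma transverse_hilb_isomorphic : isomorphic V (transverse_hilb F k m).
Proof.
exists to_hilb, of_hilb; split=> [||t Vt|I HI].
- exact: to_hilb_morphism.
- exact: of_hilb_morphism.
- have [_ e] := VP Vt; rewrite -[RHS]e /of_hilb /to_hilb.
  have [-> h] := section_idealK k (Q t) (Y t).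
  exact: Psi_ext.
- have [_ e h] := hilb_section HI; rewrite -[RHS]e /to_hilb /of_hilb.
  by have [_ -> h2] := PsiP h; apply: section_ideal_ext.
Qed.

End HilbIso.

(** * Polynomial dependence of the parametrization *)

Section PolyCoef.
Local Open Scope classical_set_scope.
Variables (K : numFieldType) (T : Type) (S : set (T -> K)).

Definition poly_coefs (p : T -> {poly K}) : Prop := forall i, poly_fun S (fun t => (p t)`_i).

Lemma poly_coefs_cst p : poly_coefs (fun=> p).
Proof. by move=> i; apply: poly_cst. Qed.

Lemma poly_coefs_add p1 p2 : poly_coefs p1 -> poly_coefs p2 -> poly_coefs (fun t => p1 t + p2 t).
Proof.
by move=> h1 h2 i; apply: eq_poly_fun (poly_add (h1 i) (h2 i)) => t; rewrite coefD.
Qed.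

Lemma poly_coefs_mul p1 p2 : poly_coefs p1 -> poly_coefs p2 -> poly_coefs (fun t => p1 t * p2 t).
Proof.
move=> h1 h2 i.
have := @poly_fun_sum K T S _ (index_enum 'I_i.+1) xpredT
  (fun j t => (p1 t)`_j * (p2 t)`_(i - j)) (fun j _ => poly_mul (h1 j) (h2 (i - j)%N)).
by apply: eq_poly_fun => t; rewrite coefM.
Qed.

Lemma poly_coefs_evp p : poly_coefs p -> poly_coefs (fun t => evp (p t)).
Proof.
move=> h i; case oi: (odd i).
  by apply: eq_poly_fun (poly_cst _ 0) => t; rewrite coef_evp oi.
by apply: eq_poly_fun (h i./2) => t; rewrite coef_evp oi.
Qed.

Lemma poly_coefs_rVpoly m (v : T -> 'rV[K]_m) : poly_mx S v -> poly_coefs (fun t => rVpoly (v t)).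
Proof.
move=> h i; case: (ltnP i m) => hi.
  by apply: eq_poly_fun (h 0 (Ordinal hi)) => t; rewrite -coef_rVpoly_ord.
apply: eq_poly_fun (poly_cst _ 0) => t.
by rewrite nth_default // (leq_trans (size_poly _ _)).
Qed.

Lemma rVpoly_coefs n (p : {poly K}) : (size p <= n)%N -> rVpoly (\row_(i < n) p`_i) = p.
Proof.
move=> sp; apply/polyP => i; case: (ltnP i n) => hi.
  by rewrite (coef_rVpoly_ord _ (Ordinal hi)) mxE.
by rewrite !nth_default // (leq_trans _ hi) // size_poly.
Qed.

Lemma poly_mx_horner_poly n k (M : T -> 'M[K]_n.+1) (p : T -> {poly K}) :
  poly_mx S M -> poly_coefs p -> (forall t, (size (p t) <= k)%N) ->
  poly_mx S (fun t => horner_mx (M t) (p t)).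
Proof.
move=> pM pp sp.
have -> : (fun t => horner_mx (M t) (p t)) =
    (fun t => horner_mx (M t) (rVpoly (\row_(i < k) (p t)`_i))).
  by apply/funext => t; rewrite rVpoly_coefs.
apply: poly_mx_horner => // i j.
by apply: eq_poly_fun (pp j) => t; rewrite mxE.
Qed.

(** Reduction modulo the characteristic polynomial is avoided by applying horner_mx to the
    first basis vector. *)
Lemma poly_mx_actmx n d k (M : T -> 'M[K]_n.+1) (a : T -> {poly K}) :
  poly_mx S M -> poly_coefs a -> (forall t, (size (a t) <= k)%N) ->
  poly_mx S (fun t => actmx d (M t) (a t)).
Proof.
move=> pM pa sa i j.
have fixed (p : {poly K}) : poly_mx S (fun t => horner_mx (M t) p).
  by apply: (poly_mx_horner_poly (k := size p)) => //; apply: poly_coefs_cst.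
have pH := poly_mx_horner_poly pM pa sa.
set e := evp (even_poly ('X^j : {poly K})); set o := evp (odd_poly ('X^j : {poly K})).
have pv : poly_mx S (fun t => (horner_mx (M t) e *m horner_mx (M t) (a t) +
    horner_mx (M t) o *m (horner_mx (M t) ('X^2 + d%:P) + - (M t *m horner_mx (M t) (a t))))
    *m (delta_mx 0 0 : 'cV[K]_n.+1)).
  apply: poly_mx_mul; last exact: poly_mx_cst.
  apply: poly_mx_add; first exact: poly_mx_mul.
  apply: poly_mx_mul => //; apply: poly_mx_add => //; apply: poly_mx_opp.
  exact: poly_mx_mul.
apply: eq_poly_fun (pv i 0) => t; rewrite [RHS]mxE /cvec /act -/e -/o.
by rewrite !(rmorphD, rmorphM, rmorphN) /= horner_mx_X.
Qed.

Variables (m n' : nat) (mu1 mu2 t1 t2 : K) (f : {poly K}) (r : nat)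
  (psi : {poly K} -> {poly K} -> {poly K}).
Hypothesis F : @fixed_factor K m n' mu1 mu2 t1 t2 f r psi.

Lemma poly_coefs_monic (q : T -> 'rV[K]_m) : poly_mx S q -> poly_coefs (fun t => monic_of (q t)).
Proof.
move=> h; apply: poly_coefs_add; first exact: poly_coefs_cst.
exact: poly_coefs_rVpoly.
Qed.

Lemma poly_coefs_eo (e o : T -> 'rV[K]_m) : poly_mx S e -> poly_mx S o ->
  poly_coefs (fun t => eo_poly (e t) (o t)).
Proof.
move=> he ho; apply: poly_coefs_add.
  by apply: poly_coefs_evp; apply: poly_coefs_rVpoly.
apply: poly_coefs_mul; last exact: poly_coefs_cst.
by apply: poly_coefs_evp; apply: poly_coefs_rVpoly.
Qed.

Lemma poly_mx_pair_of (q e o : T -> 'rV[K]_m) :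
  poly_mx S q -> poly_mx S e -> poly_mx S o ->
  poly_mx S (fun t => (pair_of n' mu1 mu2 f (q t) (e t) (o t)).1) /\
  poly_mx S (fun t => (pair_of n' mu1 mu2 f (q t) (e t) (o t)).2).
Proof.
move=> hq he ho.
have hS : poly_mx S (fun t => sum_of n' f (q t)).
  move=> i j; rewrite /sum_of; case hj: (j.+1 < n'.+1)%N.
    by apply: eq_poly_fun (poly_cst _ (i == j.+1 :> nat)%:R) => t; rewrite mxE hj.
  have hc := poly_coefs_mul (poly_coefs_evp (poly_coefs_monic hq)) (poly_coefs_cst f).
  by apply: eq_poly_fun (poly_fun_opp (hc i)) => t; rewrite mxE hj.
have hA : poly_mx S (fun t => (pair_of n' mu1 mu2 f (q t) (e t) (o t)).1).
  apply: (@poly_mx_actmx _ _ n'.+1 _ _ hS _ (fun t => num_size F (e t) (o t))).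
  apply: poly_coefs_add; first exact: poly_coefs_cst.
  by apply: poly_coefs_mul; [exact: poly_coefs_cst | exact: poly_coefs_eo].
by split=> //; apply: poly_mx_add => //; apply: poly_mx_opp.
Qed.

Lemma poly_mx_pair_den (A B : T -> 'M[K]_n'.+1) : poly_mx S A -> poly_mx S B ->
  poly_mx S (fun t => pair_den m f (A t, B t)).
Proof.
move=> hA hB i j; rewrite /pair_den /=.
have h := poly_fun_scale (- (f`_1)^-1) (poly_mx_add hA hB (inord j.*2.+1) ord_max).
by apply: eq_poly_fun h => t; rewrite [RHS]mxE.
Qed.

Lemma poly_coefs_pair_num (A B : T -> 'M[K]_n'.+1) : poly_mx S A ->
  poly_coefs (fun t => pair_num mu1 f (A t, B t)).
Proof.
move=> hA i.
have h := @poly_fun_sum K T S _ (index_enum 'I_n'.+1) xpredT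
  (fun j t => ('X^j %/ f)`_i * A t j 0) (fun j _ => poly_fun_scale _ (hA j 0)).
apply: eq_poly_fun (poly_fun_sub h (poly_cst _ ((mu1%:P %/ f)`_i))) => t.
rewrite /pair_num divpD divpN coefB; congr (_ - _).
rewrite /cpoly /rVpoly poly_def.
elim/big_rec2: _ => [|j x y _ IH]; first by rewrite div0p coef0.
by rewrite divpD coefD IH divpZl coefZ valK !mxE mulrC.
Qed.

End PolyCoef.

Section OrbitSpectral.
Local Open Scope classical_set_scope.
Variable K : numFieldType.

Lemma semisimple_orbitP n k (mu : K) (A : 'M[K]_n) : mu != 0 -> (k <= n)%N ->
  semisimple_orbit k mu A <->
  A *m A = (mu ^+ 2)%:M /\ \tr A = (k%:R - (n - k)%:R) * mu.
Proof.
move=> mu0 kn; split=> [[g ug Ag]|]; first exact: diagonal_involution ug Ag.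
have := subnKC kn; move: (n - k)%N => l E; case: n / E A kn => A _ [AA tA].
exact: involution_diagonal.
Qed.

Lemma D1_spectral m (mu1 mu2 : K) AB : mu1 != 0 -> mu2 != 0 ->
  D1 m mu1 mu2 AB <-> spectral_pair mu1 mu2 mu1 mu2 AB.
Proof.
move=> h1 h2; have km : (m.+1 <= (2 * m).+1)%N by lia.
have e : (m.+1%:R - ((2 * m).+1 - m.+1)%:R) = 1 :> K.
  by rewrite (_ : ((2 * m).+1 - m.+1)%N = m); [rewrite -natr1; ring | lia].
rewrite /D1 /orbit_pairs /spectral_pair /=; split.
  move=> [/(semisimple_orbitP _ h1 km) [a ta] /(semisimple_orbitP _ h2 km) [b tb] c].
  by rewrite e !mul1r in ta tb; split; [exact: c | |].
move=> [c [a ta] [b tb]]; split=> //.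
  by apply/(semisimple_orbitP _ h1 km); rewrite e mul1r.
by apply/(semisimple_orbitP _ h2 km); rewrite e mul1r.
Qed.

Lemma D0_spectral m (mu1 mu2 : K) AB : mu1 != 0 -> mu2 != 0 ->
  D0 m mu1 mu2 AB <-> spectral_pair mu1 mu2 (2 * mu1) 0 AB.
Proof.
move=> h1 h2; have km : (m.+2 <= (2 * m).+2)%N by lia.
have km' : (m.+1 <= (2 * m).+2)%N by lia.
have e : (m.+2%:R - ((2 * m).+2 - m.+2)%:R) = 2 :> K.
  by rewrite (_ : ((2 * m).+2 - m.+2)%N = m); [rewrite -addn2 natrD; ring | lia].
have e' : (m.+1%:R - ((2 * m).+2 - m.+1)%:R) = 0 :> K.
  by rewrite (_ : ((2 * m).+2 - m.+1)%N = m.+1); [rewrite subrr | lia].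
rewrite /D0 /orbit_pairs /spectral_pair /=; split.
  move=> [/(semisimple_orbitP _ h1 km) [a ta] /(semisimple_orbitP _ h2 km') [b tb] c].
  by rewrite e in ta; rewrite e' mul0r in tb; split; [exact: c | |].
move=> [c [a ta] [b tb]]; split=> //.
  by apply/(semisimple_orbitP _ h1 km); rewrite e.
by apply/(semisimple_orbitP _ h2 km'); rewrite e' mul0r.
Qed.

End OrbitSpectral.

(** * The isomorphisms of varieties *)

(** The coordinate functions of [matrix_variety]. *)
Definition pair_coords (K : fieldType) n : set ('M[K]_n * 'M[K]_n -> K) :=
  [set f | exists i j : 'I_n,
     f = (fun AB : 'M[K]_n * 'M[K]_n => AB.1 i j) \/
     f = (fun AB : 'M[K]_n * 'M[K]_n => AB.2 i j)]%classic.

Section PairCoords.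
Local Open Scope classical_set_scope.
Variables (K : numFieldType) (m n' : nat) (mu1 mu2 : K) (f : {poly K}).
Local Notation n := n'.+1.

Lemma poly_mx_fst : poly_mx (pair_coords (K := K) (n := n)) fst.
Proof. by move=> i j; apply: poly_coord; exists i, j; left. Qed.
Lemma poly_mx_snd : poly_mx (pair_coords (K := K) (n := n)) snd.
Proof. by move=> i j; apply: poly_coord; exists i, j; right. Qed.

Lemma pair_den_regular : poly_mx (pair_coords (K := K) (n := n)) (pair_den m f).
Proof.
move=> i j; apply: eq_poly_fun (poly_mx_pair_den f poly_mx_fst poly_mx_snd i j) => AB.
by rewrite -surjective_pairing.
Qed.

Lemma pair_num_regular : poly_coefs (pair_coords (K := K) (n := n)) (pair_num mu1 f).
Proof.
move=> i; apply: eq_poly_fun (poly_coefs_pair_num mu1 f snd poly_mx_fst i) => AB.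
by rewrite -surjective_pairing.
Qed.

Lemma pair_even_regular : poly_mx (pair_coords (K := K) (n := n)) (pair_even m mu1 f).
Proof. by move=> i j; apply: eq_poly_fun (pair_num_regular j.*2) => AB; rewrite mxE. Qed.

Lemma pair_odd_regular : poly_mx (pair_coords (K := K) (n := n)) (pair_odd m mu1 f).
Proof. by move=> i j; apply: eq_poly_fun (pair_num_regular j.*2.+1) => AB; rewrite mxE. Qed.
End PairCoords.

Section Isomorphisms.
Local Open Scope classical_set_scope.
Variables (K : numFieldType) (m' : nat) (mu1 mu2 : K).
Hypotheses (mu1_neq0 : mu1 != 0) (mu2_neq0 : mu2 != 0).
Local Notation m := m'.+1.

Let i0 : 'I_3 := @Ordinal 3 0 isT.
Let i1 : 'I_3 := @Ordinal 3 1 isT.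
Let i2 : 'I_3 := @Ordinal 3 2 isT.

Let half : 'rV[K]_m := 2^-1 *: delta_mx 0 0.

Lemma rVpoly_half : rVpoly half = (2^-1)%:P.
Proof. by rewrite /half linearZ /= rVpoly_delta expr0 alg_polyC. Qed.

(** With x = u^2, y = o and z = e - 1/2, [D1_eqn] becomes the equation of the surface. *)
Lemma D1_isomorphic : isomorphic (matrix_variety (D1 m mu1 mu2))
   (transverse_hilb (D1_surface mu1 mu2) D1_x m).
Proof.
have F := D1_factor m mu1 mu2.
set f : {poly K} := 'X - _ in F.
pose Y (AB : ambient (matrix_variety (D1 m mu1 mu2))) (l : 'I_3) : 'rV[K]_m :=
  if l == i1 then pair_odd m mu1 f AB else pair_even m mu1 f AB - half.
pose Psi (q : 'rV[K]_m) (y : 'I_3 -> 'rV[K]_m) :=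
  pair_of (2 * m) mu1 mu2 f q (y i2 + half) (y i1).
have eqn q y : affine_section D1_x (D1_surface mu1 mu2) q y <->
   monic_of q %| D1_eqn mu1 mu2 (rVpoly (y i2 + half)) (rVpoly (y i1)).
  rewrite /affine_section; suff -> : restrict D1_x y (D1_surface mu1 mu2) =
    D1_eqn mu1 mu2 (rVpoly (y i2 + half)) (rVpoly (y i1)) by [].
  rewrite /D1_surface restrictD restrictZ restrictD restrictB restrictM !restrictXn restrictC.
  rewrite !restrict_var /section_fun /= /D1_eqn linearD /= rVpoly_half.
  (* completing the square: 1/4 = (1/2)^2 and 1/2 + 1/2 = 1 *)
  have h4 : (4^-1)%:P = (2^-1)%:P * (2^-1)%:P :> {poly K}.
    by rewrite -polyCM; congr (_%:P); field.
  have h2 : (2^-1)%:P + (2^-1)%:P = 1 :> {poly K}.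
    by rewrite -polyCD; congr (_%:P); field.
  rewrite -mul_polyC h4 -/i1 -/i2; move: (rVpoly (y i2)) (rVpoly (y i1)) (2^-1)%:P h2 => z w h h2.
  transitivity ('X * w ^+ 2 - (z + h) ^+ 2 + (z + h) * (h + h) + (mu1 - mu2)%:P * w).
    by ring.
  by rewrite h2 mulr1.
refine (@transverse_hilb_isomorphic K 3 m' D1_x (D1_surface mu1 mu2)
  (matrix_variety (D1 m mu1 mu2)) (pair_den m f) Y Psi (fun=> erefl) tt _ _ _ _ _ _).
- by case; apply: pair_den_regular.
- case=> l; rewrite /Y; case: (l == i1); first exact: pair_odd_regular.
  by apply: poly_mx_add; [exact: pair_even_regular | exact: poly_mx_cst].
- case=> g [i [j gE]].
  have pq : poly_mx (data_coords (K := K) (N := 3) (m' := m')) fst.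
    by move=> a b; rewrite (ord1 a); apply: poly_coord; left; exists b.
  have py l : poly_mx (data_coords (K := K) (N := 3) (m' := m')) (fun qY => qY.2 l).
    by move=> a b; rewrite (ord1 a); apply: poly_coord; right; exists l, b.
  have [hA hB] := poly_mx_pair_of F pq (poly_mx_add (py i2) (poly_mx_cst _ half)) (py i1).
  by case: gE => ->; [exact: hA | exact: hB].
- by move=> q y y' h; rewrite /Psi !h.
- move=> AB /(D1_spectral _ mu1_neq0 mu2_neq0) /(spectral_pairP F) [h1 _ _ h2].
  rewrite eqn /Psi /Y /= subrK; split=> //.
- move=> q y /eqn h; have [h1 h2 h3] := pair_ofK F h.
  split=> //.
  + by apply/(D1_spectral _ mu1_neq0 mu2_neq0); apply: (pair_of_spectral F h).
  + move=> l lk; rewrite /Y h2 h3 addrK; case: eqVneq => [->//|l1].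
    congr (y _); apply/val_inj => /=.
    move: lk l1; rewrite -!val_eqE /=; case: l => [[|[|[|]]]] //.
Qed.

Lemma D0_isomorphic : isomorphic (matrix_variety (D0 m mu1 mu2))
   (transverse_hilb (D0_surface K) D0_x m).
Proof.
have F := D0_factor m mu2 mu1_neq0.
set f : {poly K} := _ + _ in F.
pose Y (AB : ambient (matrix_variety (D0 m mu1 mu2))) (l : 'I_3) : 'rV[K]_m :=
  if l == i0 then pair_even m mu1 f AB else pair_odd m mu1 f AB.
pose Psi (q : 'rV[K]_m) (y : 'I_3 -> 'rV[K]_m) :=
  pair_of (2 * m).+1 mu1 mu2 f q (y i0) (y i1).
have eqn q y : affine_section D0_x (D0_surface K) q y <->
   monic_of q %| D0_eqn (rVpoly (y i0)) (rVpoly (y i1)).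
  rewrite /affine_section; suff -> : restrict D0_x y (D0_surface K) =
    D0_eqn (rVpoly (y i0)) (rVpoly (y i1)) by [].
  by rewrite /D0_surface restrictD restrictB restrictXn restrictM restrictXn !restrict_var
    /section_fun.
refine (@transverse_hilb_isomorphic K 3 m' D0_x (D0_surface K)
  (matrix_variety (D0 m mu1 mu2)) (pair_den m f) Y Psi (fun=> erefl) tt _ _ _ _ _ _).
- by case; apply: pair_den_regular.
- case=> l; rewrite /Y; case: (l == i0); first exact: pair_even_regular.
  exact: pair_odd_regular.
- case=> g [i [j gE]].
  have pq : poly_mx (data_coords (K := K) (N := 3) (m' := m')) fst.
    by move=> a b; rewrite (ord1 a); apply: poly_coord; left; exists b.
  have py l : poly_mx (data_coords (K := K) (N := 3) (m' := m')) (fun qY => qY.2 l).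
    by move=> a b; rewrite (ord1 a); apply: poly_coord; right; exists l, b.
  have [hA hB] := poly_mx_pair_of F pq (py i0) (py i1).
  by case: gE => ->; [exact: hA | exact: hB].
- by move=> q y y' h; rewrite /Psi !h.
- move=> AB /(D0_spectral _ mu1_neq0 mu2_neq0) /(spectral_pairP F) [h1 _ _ h2].
  by rewrite eqn /Psi /Y.
- move=> q y /eqn h; have [h1 h2 h3] := pair_ofK F h.
  split=> //.
  + by apply/(D0_spectral _ mu1_neq0 mu2_neq0); apply: (pair_of_spectral F h).
  + move=> l lk; rewrite /Y h2 h3; case: eqVneq => [->//|l1].
    congr (y _); apply/val_inj => /=.
    by move: lk l1; rewrite -!val_eqE /=; case: l => [[|[|[|]]]].
Qed.
End Isomorphisms.

Section Biholomorphic.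
Local Open Scope classical_set_scope.
Variables (K : numFieldType).

Lemma poly_fun_differentiable (V : normedModType K) (S : set (V -> K)) (g : V -> K) :
  (forall s, S s -> forall x, differentiable (s : V -> K^o) x) -> poly_fun S g ->
  forall x, differentiable (g : V -> K^o) x.
Proof.
move=> dS; elim=> [c|s /dS //|g1 g2 _ h1 _ h2|g1 g2 _ h1 _ h2] x.
- exact: differentiable_cst.
- exact: (@differentiableD K V K^o).
- exact: (@differentiableM K V).
Qed.

Lemma poly_mx_differentiable (V : normedModType K) (S : set (V -> K)) m n (M : V -> 'M[K]_(m, n)) :
  (forall s, S s -> forall x, differentiable (s : V -> K^o) x) -> poly_mx S M ->
  forall x, differentiable M x.
Proof.
move=> dS pM x.
have -> : M = \sum_(i < m) (fun y => \sum_(j < n) M y i j *: (delta_mx i j : 'M[K]_(m, n))).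
  apply/funext => y; rewrite fct_sumE; exact: matrix_sum_delta.
apply: differentiable_sum => i.
have -> : (fun y => \sum_(j < n) M y i j *: (delta_mx i j : 'M[K]_(m, n))) =
   \sum_(j < n) (fun y => M y i j *: (delta_mx i j : 'M[K]_(m, n))).
  by apply/funext => y; rewrite fct_sumE.
apply: differentiable_sum => j.
apply: differentiableZl; exact: (poly_fun_differentiable dS (pM i j)).
Qed.

Lemma poly_pair_holomorphic (V : normedModType K) (S : set (V -> K)) m n m2 n2 (X : set V)
   (M : V -> 'M[K]_(m, n)) (L : V -> 'M[K]_(m2, n2)) :
  (forall s, S s -> forall x, differentiable (s : V -> K^o) x) ->
  poly_mx S M -> poly_mx S L -> holomorphic_on X (fun v => (M v, L v)).
Proof.
move=> dS pM pL x _; exists (fun v => (M v, L v)); split; last exact: nearW.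
apply: nearW => y; apply: differentiable_pair.
  exact: poly_mx_differentiable dS pM y.
exact: poly_mx_differentiable dS pL y.
Qed.
End Biholomorphic.

(** * Rational maps *)

Section SymmetricRational.
Local Open Scope classical_set_scope.
Variables (K : numFieldType).

Definition mx_pair_coords m n p q : set ('M[K]_(m, n) * 'M[K]_(p, q) -> K) :=
  [set f | (exists i j, f = fun AB : 'M[K]_(m, n) * 'M[K]_(p, q) => AB.1 i j) \/
           (exists i j, f = fun AB : 'M[K]_(m, n) * 'M[K]_(p, q) => AB.2 i j)].

Lemma mx_pair_coords_differentiable m n p q s :
  mx_pair_coords (m := m) (n := n) (p := p) (q := q) s ->
  forall x, differentiable (s : _ -> K^o) x.
Proof.
move=> [] [i [j ->]] x.
  apply: (@differentiable_comp K _ _ _ fst (fun M : 'M[K]_(m, n) => M i j : K^o)).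
    apply: linear_differentiable => y; exact: cvg_fst.
  exact: differentiable_coord.
apply: (@differentiable_comp K _ _ _ snd (fun M : 'M[K]_(p, q) => M i j : K^o)).
  apply: linear_differentiable => y; exact: cvg_snd.
exact: differentiable_coord.
Qed.

Variables (m' : nat) (mu : K).
Hypothesis mu_neq0 : mu != 0.
Local Notation m := m'.+1.
Let f : {poly K} := 'X - (mu + mu)%:P.

Let rat_of (AB : 'M[K]_((2 * m).+1) * 'M[K]_((2 * m).+1)) : 'rV[K]_(2 * m) * 'rV[K]_(2 * m) :=
  (\row_i (2 *: pair_num mu f AB - 1)`_i,
   \row_i (evp (monic_of (pair_den m f AB)))`_i).

Let rat_num_half (v : 'rV[K]_(2 * m) * 'rV[K]_(2 * m)) : {poly K} :=
  2^-1 *: (rVpoly v.1 + 1).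
Let rat_even v : 'rV[K]_m := \row_i (rat_num_half v)`_i.*2.
Let rat_odd v : 'rV[K]_m := \row_i (rat_num_half v)`_i.*2.+1.
Let rat_sqr_den (v : 'rV[K]_(2 * m) * 'rV[K]_(2 * m)) : 'rV[K]_m :=
  \row_i (rVpoly v.2)`_i.*2.
Let of_rat (v : 'rV[K]_(2 * m) * 'rV[K]_(2 * m)) : 'M[K]_((2 * m).+1) * 'M[K]_((2 * m).+1) :=
  pair_of (2 * m) mu mu f (rat_sqr_den v) (rat_even v) (rat_odd v).

Implicit Types (v : 'rV[K]_(2 * m) * 'rV[K]_(2 * m)) (AB : 'M[K]_((2 * m).+1) * 'M[K]_((2 * m).+1)).

(** For p = 2 b - 1 with b = e(u^2) + u o(u^2), the condition p(u) p(-u) = 1 is the equation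
    of the surface with mu1 = mu2. *)
Lemma symmetric_eqn e o :
  (2 *: (evp e + evp o * 'X) - 1) * ((2 *: (evp e + evp o * 'X) - 1) \Po (- 'X)) - 1 =
  - (4 *: evp (D1_eqn mu mu e o)) :> {poly K}.
Proof.
have tw p : evp p \Po (- 'X) = evp p.
  by rewrite /evp -comp_polyA rmorphXn /= comp_polyX sqrrN.
rewrite -!mul_polyC !(rmorphB, rmorphM, rmorphD, rmorph1) /= comp_polyX !tw.
rewrite /D1_eqn subrr !(evpD, evpN, evpM, evpXn, evpX, evpC, evp0, rmorph0).
rewrite ?polyC0; ring.
Qed.

Lemma rat_of_den AB : rat_den (rat_of AB) = evp (monic_of (pair_den m f AB)).
Proof.
have mq := monic_of_monic (pair_den m f AB); have sq := monic_of_size (pair_den m f AB).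
have me := evp_monic mq.
have se : size (evp (monic_of (pair_den m f AB))) = (2 * m).+1.
  by rewrite size_evp ?monic_neq0 // sq mul2n.
exact: (monic_ofK me se).
Qed.

Lemma rat_of_num AB : D1 m mu mu AB ->
  rat_num (rat_of AB) = 2 *: eo_poly (pair_even m mu f AB) (pair_odd m mu f AB) - 1.
Proof.
move=> /(D1_spectral _ mu_neq0 mu_neq0) /(spectral_pairP (D1_factor m mu mu)) [_ _ e _].
rewrite -e; apply: rVpoly_coefs; apply: (@leq_trans m.*2); last by rewrite mul2n.
apply: (leq_trans (size_polyD _ _)).
rewrite size_polyN size_poly1 geq_max andbT (leq_trans (size_scale_leq _ _)) //.
by rewrite e size_eo_poly.
Qed.

Lemma of_rat_eo v : eo_poly (rat_even v) (rat_odd v) = 2^-1 *: (rat_num v + 1) :> {poly K}.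
Proof.
apply: eo_polyK; apply: (leq_trans (size_scale_leq _ _)).
apply: (leq_trans (size_polyD _ _)); rewrite size_poly1 geq_max andbT -mul2n.
exact: size_poly.
Qed.

Lemma of_rat_den v (q : {poly K}) : q \is monic -> size q = m.+1 ->
  rat_den v = q \Po 'X^2 -> monic_of (rat_sqr_den v) = q.
Proof.
move=> mq sq; rewrite -/(evp q) => e; rewrite -[RHS](monic_ofK mq sq); congr monic_of.
apply/rowP => i; rewrite !mxE.
have <- : (evp q)`_i.*2 = q`_i by rewrite coef_evp odd_double doubleK.
by rewrite -e coefD coefXn ltn_eqF ?add0r //; have := ltn_ord i; clear; lia.
Qed.

Lemma unit_mod_coprime (p p' d : {poly K}) : d %| p * p' - 1 -> coprimep p d.
Proof.
move=> /dvdpP [s e]; apply/Bezout_eq1_coprimepP; exists (p', - s) => /=.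
by rewrite mulNr -e mulrC opprB addrC subrK.
Qed.

Lemma of_rat_D1 v : symmetric_rational K m v ->
  monic_of (rat_sqr_den v) %|
    D1_eqn mu mu (rVpoly (rat_even v))
      (rVpoly (rat_odd v)).
Proof.
move=> [_ [q [mq sq de]]]; rewrite (of_rat_den mq sq de) de -/(evp q).
have -> : rat_num v = 2 *: eo_poly (rat_even v) (rat_odd v) - 1.
  by rewrite of_rat_eo scalerA divff ?pnatr_eq0 // scale1r addrK.
rewrite symmetric_eqn -scaleNr dvdpZr ?oppr_eq0 ?pnatr_eq0 //.
by rewrite dvdp_evp.
Qed.

Lemma monic_of_inj : injective (@monic_of K m).
Proof. by move=> p q pq; apply/rowP => i; rewrite -!monic_of_coef pq. Qed.

Lemma rat_inj v1 v2 : rat_num v1 = rat_num v2 -> rat_den v1 = rat_den v2 -> v1 = v2.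
Proof.
case: v1 v2 => [n1 d1] [n2 d2]; rewrite /rat_num /rat_den /= => hn /addrI hd.
by rewrite -[n1]rVpolyK hn rVpolyK -[d1]rVpolyK hd rVpolyK.
Qed.

Lemma rat_ofK AB : D1 m mu mu AB -> of_rat (rat_of AB) = AB.
Proof.
move=> hAB.
have [_ _ _ e] := spectral_pairP (D1_factor m mu mu) ((D1_spectral _ mu_neq0 mu_neq0).1 hAB).
transitivity (pair_of (2 * m) mu mu f
  (pair_den m f AB) (pair_even m mu f AB) (pair_odd m mu f AB)); last exact: e.
have E1 : rat_sqr_den (rat_of AB) = pair_den m f AB.
  apply: monic_of_inj; apply: of_rat_den.
  - exact: monic_of_monic.
  - exact: monic_of_size.
  - exact: rat_of_den.
have hb : rat_num_half (rat_of AB) = eo_poly (pair_even m mu f AB) (pair_odd m mu f AB).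
  have := rat_of_num hAB; rewrite /rat_num_half /rat_num => ->.
  by rewrite subrK scalerA mulVf ?pnatr_eq0 // scale1r.
have E2 : rat_even (rat_of AB) = pair_even m mu f AB.
  by apply/rowP => i; rewrite mxE hb (eo_poly_coef _ _ i).1.
have E3 : rat_odd (rat_of AB) = pair_odd m mu f AB.
  by apply/rowP => i; rewrite mxE hb (eo_poly_coef _ _ i).2.
by rewrite /of_rat E1 E2 E3.
Qed.

Lemma of_ratK v : symmetric_rational K m v -> rat_of (of_rat v) = v.
Proof.
move=> hv; have hd := of_rat_D1 hv; have F := D1_factor m mu mu.
have [h1 h2 h3] := pair_ofK F hd.
have hAB : D1 m mu mu (of_rat v).
  by apply/(D1_spectral _ mu_neq0 mu_neq0); exact: (pair_of_spectral F hd).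
apply: rat_inj.
  rewrite rat_of_num // /of_rat h2 h3 of_rat_eo scalerA divff ?pnatr_eq0 //.
  by rewrite scale1r addrK.
have [_ [q [mq sq de]]] := hv.
by rewrite rat_of_den /of_rat h1 (of_rat_den mq sq de) de.
Qed.

Lemma D1_biholomorphic : biholomorphic (D1 m mu mu) (symmetric_rational K m).
Proof.
have F := D1_factor m mu mu; rewrite -/f in F.
have dcoord s : pair_coords s ->
    forall x, differentiable (s : 'M[K]_((2 * m).+1) * 'M[K]_((2 * m).+1) -> K^o) x.
  by move=> [i [j [->|->]]]; apply: mx_pair_coords_differentiable; [left|right]; exists i, j.
exists rat_of, of_rat; split.
- split.
    have hn : poly_mx (pair_coords (K := K) (n := (2 * m).+1))
        (fun AB => \row_(i < 2 * m) (2 *: pair_num mu f AB - 1)`_i).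
      move=> i j; have h := poly_fun_sub (poly_fun_scale 2 (pair_num_regular (2 * m) mu f j))
        (poly_cst _ (1 : {poly K})`_j).
      by apply: eq_poly_fun h => AB; rewrite mxE coefB coefZ.
    have hd : poly_mx (pair_coords (K := K) (n := (2 * m).+1))
        (fun AB => \row_(i < 2 * m) (evp (monic_of (pair_den m f AB)))`_i).
      have h := poly_coefs_evp (poly_coefs_monic (@pair_den_regular K m (2 * m) f)).
      by move=> i j; apply: eq_poly_fun (h j) => AB; rewrite mxE.
    exact: poly_pair_holomorphic dcoord hn hd.
  pose C := mx_pair_coords (m := 1) (n := 2 * m) (p := 1) (q := 2 * m).
  have p1 : poly_mx C fst.
    by move=> i j; apply: poly_coord; left; exists i, j.
  have p2 : poly_mx C snd.
    by move=> i j; apply: poly_coord; right; exists i, j.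
  have pb : poly_coefs C rat_num_half.
    move=> i; have := poly_coefs_add (poly_coefs_rVpoly p1) (poly_coefs_cst _ 1).
    by move=> /(_ i) /(poly_fun_scale 2^-1); apply: eq_poly_fun => v; rewrite coefZ.
  have pq : poly_mx C rat_sqr_den.
    by move=> i j; apply: eq_poly_fun (poly_coefs_rVpoly p2 j.*2) => v; rewrite mxE.
  have pe : poly_mx C rat_even.
    by move=> i j; apply: eq_poly_fun (pb j.*2) => v; rewrite mxE.
  have po : poly_mx C rat_odd.
    by move=> i j; apply: eq_poly_fun (pb j.*2.+1) => v; rewrite mxE.
  have [hA hB] := poly_mx_pair_of F pq pe po.
  have := poly_pair_holomorphic (@mx_pair_coords_differentiable _ _ _ _) hA hB.
  by apply.
- move=> AB hAB; have hd := rat_of_den AB; have hn := rat_of_num hAB.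
  have [h1 _ _ _] := spectral_pairP F ((D1_spectral _ mu_neq0 mu_neq0).1 hAB).
  have dv : rat_den (rat_of AB) %| rat_num (rat_of AB) * (rat_num (rat_of AB) \Po (- 'X)) - 1.
    rewrite hd hn symmetric_eqn -scaleNr dvdpZr ?oppr_eq0 ?pnatr_eq0 //.
    by rewrite dvdp_evp.
  split; first exact: unit_mod_coprime dv.
  exists (monic_of (pair_den m f AB)); split=> //; [exact: monic_of_monic | exact: monic_of_size].
- move=> v /of_rat_D1 hv; apply/(D1_spectral _ mu_neq0 mu_neq0).
  exact: (pair_of_spectral F hv).
- exact: rat_ofK.
- exact: of_ratK.
Qed.

End SymmetricRational.

(** * The theorem *)

Unset Implicit Arguments.

Theorem theorem7p3 (R : realType) (m : nat) (hm : (1 <= m)%N) :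
  (forall mu1 mu2 : R[i], mu1 != 0 -> mu2 != 0 ->
     isomorphic (matrix_variety (D1 m mu1 mu2))
                (transverse_hilb (D1_surface mu1 mu2) D1_x m) /\
     isomorphic (matrix_variety (D0 m mu1 mu2))
                (transverse_hilb (D0_surface R[i]) D0_x m)) /\
  (forall mu : R[i], mu != 0 ->
     biholomorphic (D1 m mu mu) (symmetric_rational R[i] m)).
Proof.
case: m hm => // m' _; split=> [mu1 mu2 h1 h2|mu h].
  by split; [exact: D1_isomorphic | exact: D0_isomorphic].
exact: D1_biholomorphic.
Qed.
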